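(* For every $\Sigma^1_1$ set $P \subseteq \mathbb{N}$ there exist a finite alphabet $S$ and a cellular automaton $f$ on the full shift $S^{\mathbb{Z}}$ such that $P$ is many-one reducible to the language of the nonwandering set $\mathcal{N}(f)$. In particular, there exists a cellular automaton on a full shift whose nonwandering set has a $\Sigma^1_1$-complete language.
   Context: A cellular automaton on $X = S^{\mathbb{Z}}$ (product topology) is a continuous shift-commuting map $f: X \to X$. The nonwandering set of $f$ is $\mathcal{N}(f) = \{x \in X \mid x \in \bigcap_{n \in \mathbb{N}} \overline{\bigcup_{k \geq n} \{f^k(x)\}}\}$. The language of $Y \subseteq S^{\mathbb{Z}}$ is the set of words $w \in S^*$ with $w = y_{[0,k-1]}$ for some $y\in Y$, $k \in \mathbb{N}$, viewed as a subset of $\mathbb{N}$ via a computable bijection. A set $P \subseteq \mathbb{N}$ is $\Sigma^1_1$ if $w \in P \iff (\exists C \subseteq \mathbb{N})(\forall m \in \mathbb{N})(\exists \ell \in \mathbb{N}) R(C,m,\ell,w)$ for some recursive predicate $R$; it is $\Sigma^1_1$-complete if it is $\Sigma^1_1$ and every $\Sigma^1_1$ set many-one (computably) reduces to it. *)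

(* Defs.v *)
From mathcomp Require Import all_boot all_order all_algebra.
Set Implicit Arguments. Unset Strict Implicit. Unset Printing Implicit Defensive.

Inductive prf : Type :=
| PZero : prf
| PSucc : prf
| PProj : nat -> prf
| POrc : prf
| PComp : prf -> list prf -> prf
| PPrec : prf -> prf -> prf
| PMu : prf -> prf.

Inductive evalp (C : nat -> bool) : prf -> list nat -> nat -> Prop :=
| ev_zero xs : evalp C PZero xs 0
| ev_succ xs : evalp C PSucc xs (nth 0 xs 0).+1
| ev_proj i xs : evalp C (PProj i) xs (nth 0 xs i)
| ev_orc xs : evalp C POrc xs (nat_of_bool (C (nth 0 xs 0)))
| ev_comp f gs xs ys y :
    evall C gs xs ys -> evalp C f ys y -> evalp C (PComp f gs) xs y
| ev_prec0 f g xs y : evalp C f xs y -> evalp C (PPrec f g) (0 :: xs) y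
| ev_precS f g n xs r y :
    evalp C (PPrec f g) (n :: xs) r -> evalp C g (n :: r :: xs) y ->
    evalp C (PPrec f g) (n.+1 :: xs) y
| ev_mu f xs y :
    evalp C f (y :: xs) 0 ->
    (forall z, z < y -> exists v, evalp C f (z :: xs) v.+1) ->
    evalp C (PMu f) xs y
with evall (C : nat -> bool) : list prf -> list nat -> list nat -> Prop :=
| evl_nil xs : evall C nil xs nil
| evl_cons g gs xs y ys :
    evalp C g xs y -> evall C gs xs ys -> evall C (g :: gs) xs (y :: ys).

Definition computable (h : nat -> nat) : Prop :=
  exists e : prf, forall n, evalp (fun _ => false) e [:: n] (h n).

Definition recursive_pred (R : (nat -> bool) -> nat -> nat -> nat -> bool) : Prop :=
  exists e : prf, forall C m l w, evalp C e [:: m; l; w] (nat_of_bool (R C m l w)).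

Definition Sigma11 (P : nat -> Prop) : Prop :=
  exists R, recursive_pred R /\
    forall w, P w <-> exists C : nat -> bool, forall m, exists l, R C m l w.

Definition many_one (P Q : nat -> Prop) : Prop :=
  exists h, computable h /\ forall w, P w <-> Q (h w).

Definition Sigma11_complete (Q : nat -> Prop) : Prop :=
  Sigma11 Q /\ forall P, Sigma11 P -> many_one P Q.

Definition config (S : finType) := int -> S.

(* x and y agree on the window [-n, n]; these cylinders form a basis of    *)
(* neighbourhoods of x in the product topology.                            *)
Definition agree (S : finType) (n : nat) (x y : config S) : Prop :=
  forall i : int, (absz i <= n)%N -> x i = y i.

Definition shift (S : finType) (x : config S) : config S := fun i => x (i + 1)%R.

Definition continuous_cfg (S : finType) (f : config S -> config S) : Prop :=
  forall (x : config S) (n : nat), exists m : nat,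
    forall y, agree m x y -> agree n (f x) (f y).

Definition cellular_automaton (S : finType) (f : config S -> config S) : Prop :=
  continuous_cfg f /\ forall x, f (shift x) = shift (f x).

Definition closure_cfg (S : finType) (A : config S -> Prop) (x : config S) : Prop :=
  forall n : nat, exists y, A y /\ agree n x y.

Definition nonwandering (S : finType) (f : config S -> config S) (x : config S) : Prop :=
  forall n : nat, closure_cfg (fun y => exists2 k, (n <= k)%N & y = iter k f x) x.

(* Words over S coded by naturals via the computable bijection of           *)
(* bijective base-|S| numeration (first letter least significant):          *)
(*   code [a_0; ...; a_{k-1}] = sum_i (rank a_i + 1) * |S|^i.              *)
Definition code_word (S : finType) (w : seq S) : nat :=
  foldr (fun a acc => (enum_rank a).+1 + #|S| * acc)%N 0%N w.

Definition language (S : finType) (Y : config S -> Prop) (c : nat) : Prop :=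
  exists y, Y y /\ exists k : nat, c = code_word (mkseq (fun i => y (Posz i)) k).

(* Main.v *)
Require Import Defs.
From mathcomp Require Import all_boot all_order all_algebra zify boolp.
Set Implicit Arguments. Unset Strict Implicit. Unset Printing Implicit Defensive.

(* Reduction: the automaton moves one head along a half-line of cells.  Each cell
   shows on which side the head lies, and local inconsistencies create an error
   symbol that spreads, so a recurrent configuration with the starting letter at
   the origin has a unique head and uncorrupted unary registers.  The tape holds
   a guessed oracle and the infinite bit string of a binary odometer.  At each
   visit of the starting state the machine increments the odometer, takes the
   carry position as m, searches l with R(C,m,l,w) and erases its registers.
   Coming back to the start with the first m+1 odometer bits restored requires a
   carry stopping at m, hence every m is verified; conversely, if every search
   succeeds, the orbit of the zero odometer returns to it in every window.

   Completeness: an oracle can guess the whole set of true facts "program e maps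
   xs to y", each of which is justified locally by facts about structurally
   smaller programs or smaller recursion arguments, so a universal set is Sigma11
   without an interpreter.  The language of recurrent points is Sigma11 in the
   same way, the oracle guessing the space-time diagram. *)

(** * Primitive recursive programs *)

(** Recurrence supplies the quantifiers: the configuration carries C, the window of a return is m,
    and the search that lets the head come back yields l. The obstacle is that a return must restore
    the window exactly, while infinitely many m have to be treated. A counter stored as a growing
    number would never come back; adding one to a 2-adic integer does come back in every window, and
    a larger window forces a longer carry. The other difficulty is that a word prescribes only
    finitely many letters. The rest of the configuration, odometer bits included, is arbitrary, so
    the argument from recurrence to P must work for every initial odometer value, and a carry that
    runs off to infinity or a search that fails must be seen to prevent a return. Unary registers
    help here: being an initial segment of the cells is a local condition, and a register empty at
    the origin is empty everywhere. The side marks likewise make uniqueness of the head a local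
    condition. *)

Fixpoint All (Q : prf -> Prop) (gs : list prf) : Prop :=
  if gs is g :: gs' then Q g /\ All Q gs' else True.

(** The generated principle gives no hypothesis on the programs inside the list of [PComp]. *)
Lemma prf_nested_ind (Q : prf -> Prop) :
  Q PZero -> Q PSucc -> (forall i, Q (PProj i)) -> Q POrc ->
  (forall f gs, Q f -> All Q gs -> Q (PComp f gs)) ->
  (forall f g, Q f -> Q g -> Q (PPrec f g)) -> (forall f, Q f -> Q (PMu f)) ->
  forall e, Q e.
Proof.
move=> Hz Hs Hp Ho Hc Hr Hm; fix IH 1; case; [exact: Hz|exact: Hs|exact: Hp|exact: Ho| | |].
- move=> f gs; apply: Hc => //.
  by elim: gs => //= g gs IHgs; split.
- by move=> f g; apply: Hr.
- by move=> f; apply: Hm.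
Qed.

(* Junk value 0 on minimisation and on recursion without argument, both excluded *)
(* by [primrec].                                                                *)
Fixpoint ev (C : nat -> bool) (e : prf) (xs : seq nat) : nat :=
  match e with
  | PZero => 0
  | PSucc => (nth 0 xs 0).+1
  | PProj i => nth 0 xs i
  | POrc => C (nth 0 xs 0)
  | PComp f gs => ev C f [seq ev C g xs | g <- gs]
  | PPrec f g =>
      if xs is n :: xs' then iteri n (fun i r => ev C g [:: i, r & xs']) (ev C f xs')
      else 0
  | PMu _ => 0
  end.

(** [K] is the number of arguments. Projections are unrestricted because [evalp] reads a missing
    argument as 0. *)
Fixpoint primrec (K : nat) (e : prf) : bool :=
  match e with
  | PComp f gs => all (primrec K) gs && primrec (size gs) f
  | PPrec f g => if K is K'.+1 then primrec K' f && primrec K'.+2 g else false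
  | PMu _ => false
  | _ => true
  end.

Lemma evalp_ev C e xs : primrec (size xs) e -> evalp C e xs (ev C e xs).
Proof.
elim/prf_nested_ind: e xs => /=; try by move=> *; constructor.
- move=> f gs IHf IHgs xs /andP[wgs wf].
  apply: (@ev_comp _ _ _ _ [seq ev C g xs | g <- gs]); last first.
    by apply: IHf; rewrite size_map.
  elim: gs IHgs wgs {wf} => [|g gs IH] /=; first by constructor.
  by case=> Hg Hgs /andP[w1 w2]; constructor; [exact: Hg|exact: IH].
- move=> f g IHf IHg [//|n xs] /= /andP[wf wg].
  elim: n => [|n IHn] /=; first by constructor; apply: IHf.
  by apply: ev_precS IHn _; apply: IHg.
Qed.

Lemma primrec_computable e h :
  primrec 1 e -> (forall n, ev (fun _ => false) e [:: n] = h n) -> computable h.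
Proof. by move=> we H; exists e => n; rewrite -H; apply: evalp_ev. Qed.

Lemma primrec_recursive_pred e (R : (nat -> bool) -> nat -> nat -> nat -> bool) :
  primrec 3 e -> (forall C m l w, ev C e [:: m; l; w] = R C m l w) ->
  recursive_pred R.
Proof. by move=> we H; exists e => C m l w; rewrite -H; apply: evalp_ev. Qed.

Lemma many_one_trans (P Q T : nat -> Prop) :
  many_one P Q -> many_one Q T -> many_one P T.
Proof.
move=> [h [[e He] Ph]] [g [[d Hd] Qg]]; exists (g \o h); split; last first.
  by move=> w /=; rewrite Ph.
exists (PComp d [:: e]) => n; apply: ev_comp (Hd _).
by apply: evl_cons (He n) _; constructor.
Qed.

Definition app1 f a := PComp f [:: a].
Definition app2 f a b := PComp f [:: a; b].
Definition app3 f a b c := PComp f [:: a; b; c].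

(** * Arithmetic and comparison programs *)

Fixpoint pconst n := if n is n'.+1 then app1 PSucc (pconst n') else PZero.
Definition padd := PPrec (PProj 0) (app1 PSucc (PProj 1)).
Definition pmul := PPrec PZero (app2 padd (PProj 1) (PProj 2)).
Definition ppred := PPrec PZero (PProj 0).
Definition psub := app2 (PPrec (PProj 0) (app1 ppred (PProj 1))) (PProj 1) (PProj 0).
Definition pnot := PPrec (pconst 1) PZero.
Definition pif := PPrec (PProj 1) (PProj 2).
Definition peq :=
  app1 pnot (app2 padd (app2 psub (PProj 0) (PProj 1)) (app2 psub (PProj 1) (PProj 0))).
Definition pleq := app1 pnot psub.

Section PrimrecLibrary.
Variable C : nat -> bool.

Lemma ev_app1 f a xs : ev C (app1 f a) xs = ev C f [:: ev C a xs].
Proof. by []. Qed.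
Lemma ev_app2 f a b xs : ev C (app2 f a b) xs = ev C f [:: ev C a xs; ev C b xs].
Proof. by []. Qed.
Lemma ev_app3 f a b c xs :
  ev C (app3 f a b c) xs = ev C f [:: ev C a xs; ev C b xs; ev C c xs].
Proof. by []. Qed.
Lemma ev_PProj i xs : ev C (PProj i) xs = nth 0 xs i. Proof. by []. Qed.
Lemma ev_PZero xs : ev C PZero xs = 0. Proof. by []. Qed.
Lemma ev_PSucc x : ev C PSucc [:: x] = x.+1. Proof. by []. Qed.
Lemma ev_POrc x : ev C POrc [:: x] = C x. Proof. by []. Qed.

Lemma ev_PPrec0 f g xs : ev C (PPrec f g) (0 :: xs) = ev C f xs.
Proof. by []. Qed.
Lemma ev_PPrecS f g n xs :
  ev C (PPrec f g) (n.+1 :: xs) = ev C g [:: n, ev C (PPrec f g) (n :: xs) & xs].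
Proof. by []. Qed.

Lemma ev_const n xs : ev C (pconst n) xs = n.
Proof. by elim: n => //= n ->. Qed.
Lemma ev_add a b : ev C padd [:: a; b] = a + b.
Proof. by rewrite /=; elim: a => //= a ->. Qed.
Lemma ev_mul a b : ev C pmul [:: a; b] = a * b.
Proof.
by elim: a => // a IH; rewrite /pmul ev_PPrecS -/pmul IH ev_app2 ev_add mulSn addnC.
Qed.
Lemma ev_pred a : ev C ppred [:: a] = a.-1.
Proof. by case: a. Qed.
Lemma ev_sub a b : ev C psub [:: a; b] = a - b.
Proof. by rewrite /=; elim: b => [|b /= ->]; rewrite ?subn0 // subnS; case: (a - b). Qed.
Lemma ev_not a : ev C pnot [:: a] = (a == 0).
Proof. by case: a. Qed.
Lemma ev_if c a b : ev C pif [:: c; a; b] = if c == 0 then b else a.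
Proof. by case: c. Qed.
Lemma ev_eq a b : ev C peq [:: a; b] = (a == b).
Proof.
have -> : ev C peq [:: a; b] =
  ev C pnot [:: ev C padd [:: ev C psub [:: a; b]; ev C psub [:: b; a]]] by [].
rewrite ev_add !ev_sub ev_not.
by congr nat_of_bool; rewrite addn_eq0 !subn_eq0 eqn_leq.
Qed.
Lemma ev_leq a b : ev C pleq [:: a; b] = (a <= b).
Proof. by rewrite -[LHS]/(ev C pnot [:: ev C psub [:: a; b]]) ev_sub ev_not. Qed.
End PrimrecLibrary.

Lemma primrec_const K n : primrec K (pconst n).
Proof. by elim: n => //= n ->. Qed.
(* The [app] rules come last: they match library programs up to unfolding.      *)
Definition evE := (ev_add, ev_mul, ev_pred, ev_sub, ev_not, ev_if, ev_eq, ev_leq,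
  ev_const, ev_PZero, ev_PSucc, ev_PProj, ev_POrc, ev_app1, ev_app2, ev_app3).
Global Opaque padd pmul ppred psub pnot pif peq pleq.


(** * The Cantor pairing and its inverse *)

Fixpoint tri n := if n is n'.+1 then tri n' + n else 0.
Definition cantor a b := tri (a + b) + b.
(** The largest d with [tri d <= n], found by recursion on n instead of a search so that its program
    avoids [PMu]. *)
Fixpoint diag n :=
  if n is n'.+1 then (if tri (diag n').+1 <= n then (diag n').+1 else diag n') else 0.
Definition snd_of n := n - tri (diag n).
Definition fst_of n := diag n - snd_of n.

Lemma leq_tri a b : a <= b -> tri a <= tri b.
Proof. elim: b a => [|b IH] a; first by rewrite leqn0 => /eqP->.
rewrite leq_eqVlt => /orP[/eqP-> //|]; rewrite ltnS => /IH /=; lia. Qed.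

Lemma diagP n : tri (diag n) <= n < tri (diag n).+1.
Proof.
elim: n => // n /=; case: ifP => /=; case: (diag n) => [|d] /=; lia.
Qed.

Lemma diag_pair a b : diag (cantor a b) = a + b.
Proof.
have /andP[H1 H2] := diagP (cantor a b).
apply/eqP; rewrite eqn_leq; apply/andP; split; rewrite leqNgt; apply/negP => H.
  by have := leq_tri H; rewrite /= /cantor in H1 H2 *; lia.
by have := leq_tri H; move: H2; rewrite /= /cantor; lia.
Qed.

Lemma snd_pair a b : snd_of (cantor a b) = b.
Proof. by rewrite /snd_of diag_pair /cantor addKn. Qed.
Lemma fst_pair a b : fst_of (cantor a b) = a.
Proof. by rewrite /fst_of snd_pair diag_pair addnK. Qed.
Definition pairK := (fst_pair, snd_pair).

Definition ptri := PPrec PZero (app2 padd (PProj 1) (app1 PSucc (PProj 0))).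
Definition ppair :=
  app2 padd (app1 ptri (app2 padd (PProj 0) (PProj 1))) (PProj 1).
Definition pdiag := PPrec PZero
  (app3 pif (app2 pleq (app1 ptri (app1 PSucc (PProj 1))) (app1 PSucc (PProj 0)))
     (app1 PSucc (PProj 1)) (PProj 1)).
Definition psnd := app2 psub (PProj 0) (app1 ptri (app1 pdiag (PProj 0))).
Definition pfst := app2 psub (app1 pdiag (PProj 0)) (app1 psnd (PProj 0)).

Lemma primrec_pairs : [&& primrec 2 ppair, primrec 1 pfst & primrec 1 psnd].
Proof. by []. Qed.

Lemma ev_ptri C n : ev C ptri [:: n] = tri n.
Proof. by elim: n => // n IH; rewrite /ptri ev_PPrecS -/ptri IH !evE. Qed.
Global Opaque ptri.
Lemma ev_ppair C a b : ev C ppair [:: a; b] = cantor a b.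
Proof. by rewrite /ppair !(ev_ptri, evE). Qed.
Lemma ev_pdiag C n : ev C pdiag [:: n] = diag n.
Proof.
elim: n => // n IH.
by rewrite /pdiag ev_PPrecS -/pdiag IH !(ev_ptri, evE) /=; case: (_ <= _).
Qed.
Global Opaque pdiag.
Lemma ev_psnd C n : ev C psnd [:: n] = snd_of n.
Proof. by rewrite /psnd !(ev_pdiag, ev_ptri, evE). Qed.
Global Opaque psnd.
Lemma ev_pfst C n : ev C pfst [:: n] = fst_of n.
Proof. by rewrite /pfst !(ev_psnd, ev_pdiag, evE). Qed.
Global Opaque ppair pfst cantor fst_of snd_of.

(** * A universal Sigma11 set *)

(** For minimisation, compare the two results: the smaller one is a zero of the program, whereas
    minimality of the larger one makes the program positive there. *)
Lemma evalp_functional C e xs y y' : evalp C e xs y -> evalp C e xs y' -> y = y'.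
Proof.
elim/prf_nested_ind: e xs y y' => [||i|| f gs IHf IHgs | f g IHf IHg | f IHf] xs y y' H H'.
1-4: by inversion H; inversion H'; subst.
- inversion H as [ | | | |f1 gs1 xs1 ys y1 Hgs Hf | | | ]; subst.
  inversion H' as [ | | | |f1 gs1 xs1 ys' y1 Hgs' Hf' | | | ]; subst.
  suff E : ys = ys' by move: Hf'; rewrite -E => /(IHf _ _ _ Hf).
  elim: gs IHgs ys ys' Hgs Hgs' {H H' Hf Hf'} => [_|g gs IH /= [Hg /IH{}IH]] ys ys' E E'.
    by inversion E; inversion E'.
  inversion E; inversion E'; subst; congr cons; [apply: Hg|apply: IH]; eassumption.
- case: xs H H' => [|n xs] H H'; first by inversion H.
  elim: n y y' H H' => [|n IHn] y y' H H'.
    by inversion H; inversion H'; subst; apply: IHf; eauto.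
  inversion H as [ | | | | | |f1 g1 n1 xs1 r y1 Hr Hy | ]; subst.
  inversion H' as [ | | | | | |f1 g1 n1 xs1 r' y1 Hr' Hy' | ]; subst.
  by rewrite (IHn _ _ Hr' Hr) in Hy'; apply: IHg Hy Hy'.
- inversion H as [ | | | | | | |f1 xs1 y1 H0 Hp]; subst.
  inversion H' as [ | | | | | | |f1 xs1 y1 H0' Hp']; subst.
  case: (ltngtP y y') => // lt.
  + by have [v Hv] := Hp' _ lt; have := IHf _ _ _ H0 Hv.
  + by have [v Hv] := Hp _ lt; have := IHf _ _ _ H0' Hv.
Qed.

(** * Numbers for lists, programs and evaluation facts *)

Definition cons_code x l := (cantor x l).+1.
Definition lcode := foldr cons_code 0.
Definition head_of l := fst_of l.-1.
Definition tail_of l := snd_of l.-1.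
Definition nth_of i l := head_of (iter i tail_of l).

Lemma head_cons x l : head_of (cons_code x l) = x. Proof. exact: fst_pair. Qed.
Lemma tail_cons x l : tail_of (cons_code x l) = l. Proof. exact: snd_pair. Qed.

(** Head and tail of 0 are 0, so reading past the end agrees with the default value 0 of [nth]. *)
Lemma nth_lcode i xs : nth_of i (lcode xs) = nth 0 xs i.
Proof.
elim: i xs => [|i IH] [|x xs] //=; first exact: head_cons.
  by rewrite /nth_of iterSr (_ : tail_of 0 = 0) // -/(nth_of i (lcode [::])) IH nth_nil.
by rewrite /nth_of iterSr tail_cons; apply: IH.
Qed.

Fixpoint code (e : prf) : nat :=
  match e with
  | PZero => cantor 0 0
  | PSucc => cantor 1 0
  | PProj i => cantor 2 i
  | POrc => cantor 3 0
  | PComp f gs =>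
      cantor 4 (cantor (code f) (foldr (fun g r => cantor 6 (cantor (code g) r)) (cantor 5 0) gs))
  | PPrec f g => cantor 7 (cantor (code f) (code g))
  | PMu f => cantor 8 (code f)
  end.
Definition codes := foldr (fun g r => cantor 6 (cantor (code g) r)) (cantor 5 0).

(* The triple [fact e xs y] claims that the program coded by [e] maps the list  *)
(* coded by [xs] to [y]; tags 5 and 6 are lists of programs, and tag 9 claims   *)
(* that a program is positive at all points below the first argument.           *)
Definition fact e xs y := cantor e (cantor xs y).

Section Justification.
Variable C : nat -> bool.

(** The even positions of [C] hold the oracle that programs query, the odd positions the claimed
    facts. *)
Definition orc_of j := C (j + j).
Definition claim e xs y := C (fact e xs y + fact e xs y).+1.

(** [l] is the only existential: the code of the intermediate values for a composition, the previous
    value for a recursion, the predecessor of a positive value for tag 9. *)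
Definition justified_at (t a e xs y l : nat) : bool :=
  match t with
  | 0 => y == 0
  | 1 => y == (nth_of 0 xs).+1
  | 2 => y == nth_of a xs
  | 3 => y == orc_of (nth_of 0 xs)
  | 4 => claim (snd_of a) xs l && claim (fst_of a) l y
  | 5 => y == 0
  | 6 => (y == cons_code (head_of y) (tail_of y)) &&
         (claim (fst_of a) xs (head_of y) && claim (snd_of a) xs (tail_of y))
  | 7 => if xs == 0 then false else if head_of xs == 0 then claim (fst_of a) (tail_of xs) y
         else claim e (cons_code (head_of xs).-1 (tail_of xs)) l &&
           claim (snd_of a) (cons_code (head_of xs).-1 (cons_code l (tail_of xs))) y
  | 8 => claim a (cons_code y xs) 0 && claim (cantor 9 a) (cons_code y xs) 0
  | _ => if head_of xs == 0 then true
         else claim e (cons_code (head_of xs).-1 (tail_of xs)) 0 &&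
           claim a (cons_code (head_of xs).-1 (tail_of xs)) l.+1
  end.

Definition justified (m l : nat) : bool :=
  justified_at (fst_of (fst_of m)) (snd_of (fst_of m)) (fst_of m) (fst_of (snd_of m))
    (snd_of (snd_of m)) l.

(** The same m is the universal variable of the predicate and the fact to be justified; l pairs the
    two witnesses, and c pairs a program with its input. *)
Definition univ_pred (m l c : nat) : bool :=
  claim (fst_of c) (cons_code m (cons_code (fst_of l) (cons_code (snd_of c) 0))) 1 &&
  (C (m + m).+1 ==> justified m (snd_of l)).

End Justification.

Definition univ (c : nat) : Prop :=
  exists C : nat -> bool, forall m, exists l, univ_pred C m l c.

Section UnivSound.
Variable C : nat -> bool.
Hypothesis just : forall m, C (m + m).+1 -> exists l, justified C m l.
Notation D := (orc_of C).

Lemma claim_justified e xs y : claim C e xs y ->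
  exists l, justified_at C (fst_of e) (snd_of e) e xs y l.
Proof. by move=> /just[l]; rewrite /justified !pairK; exists l. Qed.

(** Circular claims do no harm: on codes of actual programs every justification descends to a
    subprogram, a smaller recursion argument or a smaller bound, and the nested inductions follow
    this descent. *)
Lemma claim_sound e xs y : claim C (code e) (lcode xs) y -> evalp D e xs y.
Proof.
elim/prf_nested_ind: e xs y => [||i|| f gs IHf IHgs | f g IHf IHg | f IHf] xs y.
- by move=> /claim_justified[l]; rewrite !pairK /= => /eqP->; constructor.
- move=> /claim_justified[l]; rewrite !pairK /= => /eqP->.
  by rewrite nth_lcode; constructor.
- move=> /claim_justified[l]; rewrite !pairK /= => /eqP->.
  by rewrite nth_lcode; constructor.
- move=> /claim_justified[l]; rewrite !pairK /= => /eqP->.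
  by rewrite nth_lcode; constructor.
- move=> /claim_justified[l]; rewrite !pairK /= !pairK -/(codes gs) => /andP[Hgs Hf].
  suff [ys E Hys] : exists2 ys, l = lcode ys & evall D gs xs ys.
    by apply: ev_comp Hys _; apply: IHf; rewrite -E.
  elim: gs l IHgs Hgs {f IHf Hf} => [|g gs IH] l /=.
    move=> _ /claim_justified[l']; rewrite !pairK /= => /eqP->.
    by exists [::] => //; constructor.
  move=> [Hg Hgs] /claim_justified[l']; rewrite !pairK /= !pairK -/(codes gs).
  case/and3P=> /eqP El /Hg Eg /(IH _ Hgs)[ys E Hys]; exists (head_of l :: ys).
    by rewrite /= -E.
  by constructor.
- case: xs => [|n xs]; first by move=> /claim_justified[l]; rewrite !pairK.
  elim: n y => [|n IHn] y /claim_justified[l].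
    by rewrite !pairK /= head_cons tail_cons !pairK /= => /IHf; constructor.
  rewrite !pairK /= !head_cons !tail_cons !pairK /= => /andP[/IHn Hr].
  by move=> /(IHg [:: n, l & xs]); apply: ev_precS.
- move=> /claim_justified[l]; rewrite !pairK /= => /andP[/(IHf (_ :: _)) H0 Hp].
  (* The tag 9 claim at the candidate minimum unrolls into positivity at each smaller point. *)
  constructor=> //; elim: (y) Hp => // n IHn /claim_justified[l'].
  rewrite !pairK /= !head_cons !tail_cons /= => /andP[/IHn{}IHn].
  move=> /(IHf (_ :: _)) Hn z; rewrite ltnS leq_eqVlt => /orP[/eqP->|/IHn //].
  by exists l'.
Qed.
End UnivSound.

Inductive true_fact (D : nat -> bool) : nat -> Prop :=
| true_eval e xs y : evalp D e xs y -> true_fact D (fact (code e) (lcode xs) y)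
| true_list gs xs ys :
    evall D gs xs ys -> true_fact D (fact (codes gs) (lcode xs) (lcode ys))
| true_pos f n xs : (forall z, z < n -> exists v, evalp D f (z :: xs) v.+1) ->
    true_fact D (fact (cantor 9 (code f)) (lcode (n :: xs)) 0).

Definition join (D : nat -> bool) (F : nat -> bool) j := if odd j then F j./2 else D j./2.

Lemma join_even D F j : join D F (j + j) = D j.
Proof. by rewrite /join addnn odd_double doubleK. Qed.
Lemma join_odd D F j : join D F (j + j).+1 = F j.
Proof. by rewrite /join addnn /= odd_double /= uphalf_double. Qed.

Section UnivComplete.
Variable D : nat -> bool.
(** Truth of a fact is undecidable in general, but the guess may be any set, so a classical truth
    value is enough. *)
Let C := join D (fun j => `[< true_fact D j >]).

Lemma claimE e xs y : true_fact D (fact e xs y) -> claim C e xs y.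
Proof. by rewrite /claim /C join_odd => /asboolP. Qed.

Lemma true_fact_justified m : C (m + m).+1 -> exists l, justified C m l.
Proof.
rewrite /C join_odd => /asboolP[e xs y H|gs xs ys H|f n xs H];
  rewrite /justified !pairK.
- inversion H as [xs1|xs1|i xs1|xs1|f gs xs1 ys y1 Hgs Hf|f g xs1 y1 Hf
    |f g n xs1 r y1 Hr Hg|f xs1 y1 H0 Hp]; subst; rewrite /= ?pairK /= ?nth_lcode;
    try by exists 0.
  + by exists 0; rewrite /orc_of /C join_even.
  + exists (lcode ys); rewrite !pairK; apply/andP; split; apply: claimE.
      exact: true_list.
    exact: true_eval.
  + by exists 0; rewrite head_cons tail_cons !pairK /=; apply/claimE/true_eval.
  + exists r; rewrite head_cons tail_cons !pairK /=; apply/andP; split; apply/claimE.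
      exact: (true_eval (e := PPrec f g) (xs := n :: xs1)).
    exact: (true_eval (xs := [:: n, r & xs1])).
  + exists 0; apply/andP; split; apply/claimE.
      exact: (true_eval (xs := y :: xs)).
    exact: true_pos.
- inversion H; subst; rewrite /= !pairK /=; exists 0 => //.
  rewrite !head_cons !tail_cons !pairK eqxx /=; apply/andP; split; apply/claimE.
    exact: true_eval.
  exact: true_list.
- rewrite /= head_cons tail_cons; case: n H => [|n] H /=; first by exists 0.
  have [v Hv] := H n (ltnSn n); exists v; apply/andP; split; apply/claimE.
    by apply: true_pos => z ltz; apply: H; apply: ltnW.
  exact: (true_eval (xs := n :: xs)).
Qed.
End UnivComplete.

Lemma Sigma11_univ_reduce P : Sigma11 P -> many_one P univ.
Proof.
move=> [R [[e He] PR]]; exists (fun w => cantor (code e) w); split.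
  exists (app2 ppair (pconst (code e)) (PProj 0)) => n.
  rewrite (_ : cantor _ _ = ev (fun _ => false) (app2 ppair (pconst (code e)) (PProj 0)) [:: n]).
    by apply: evalp_ev; rewrite /= primrec_const; case/and3P: primrec_pairs.
  by rewrite !(ev_ppair, evE).
move=> w; rewrite PR; split=> [[D HD]|[C HC]].
  exists (join D (fun j => `[< true_fact D j >])) => m.
  have [l Rl] := HD m.
  have [l' Hl'] : exists l', join D (fun j => `[< true_fact D j >]) (m + m).+1 ->
      justified (join D (fun j => `[< true_fact D j >])) m l'.
    by case: (boolP (join _ _ _)) => [/true_fact_justified[l']|]; [exists l'|exists 0].
  exists (cantor l l'); rewrite /univ_pred !pairK; apply/andP; split; last exact/implyP.
  apply/claimE/(true_eval (xs := [:: m; l; w])).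
  by have := He D m l w; rewrite Rl.
have just m : C (m + m).+1 -> exists l, justified C m l.
  by move=> Cm; have [l /andP[_]] := HC m; rewrite Cm /= => ?; exists (snd_of l).
exists (orc_of C) => m; have [l] := HC m; rewrite /univ_pred !pairK => /andP[H _].
exists (fst_of l); have /= := claim_sound just (xs := [:: m; _; w]) H.
(* The claim gives the value 1, and functionality turns it into truth of [R]. *)
by move=> /(evalp_functional (He (orc_of C) m (fst_of l) w)); case: (R _ _ _ _).
Qed.

(** * Programs for lists and for the justification predicate *)

Definition pcons := app1 PSucc ppair.
Definition phead := app1 pfst ppred.
Definition ptail := app1 psnd ppred.
Definition pnth := app1 phead (PPrec (PProj 0) (app1 ptail (PProj 1))).

Definition pclaim := app1 POrc (app1 PSucc (app2 padd
  (app2 ppair (PProj 0) (app2 ppair (PProj 1) (PProj 2)))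
  (app2 ppair (PProj 0) (app2 ppair (PProj 1) (PProj 2))))).

Section ListPrograms.
Variable C : nat -> bool.

Lemma ev_cons x l : ev C pcons [:: x; l] = cons_code x l.
Proof. by rewrite -[LHS]/(ev C ppair [:: x; l]).+1 ev_ppair. Qed.
Lemma ev_head l : ev C phead [:: l] = head_of l.
Proof. by rewrite -[LHS]/(ev C pfst [:: ev C ppred [:: l]]) ev_pred ev_pfst. Qed.
Lemma ev_tail l : ev C ptail [:: l] = tail_of l.
Proof. by rewrite -[LHS]/(ev C psnd [:: ev C ppred [:: l]]) ev_pred ev_psnd. Qed.
Lemma ev_nth i l : ev C pnth [:: i; l] = nth_of i l.
Proof.
rewrite -[LHS]/(ev C phead [:: ev C (PPrec (PProj 0) (app1 ptail (PProj 1))) [:: i; l]]).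
rewrite ev_head; congr head_of; elim: i => // i IH.
by rewrite ev_PPrecS IH !(ev_tail, evE).
Qed.
Lemma ev_claim e xs y : ev C pclaim [:: e; xs; y] = claim C e xs y.
Proof. by rewrite /pclaim !(ev_ppair, evE). Qed.
End ListPrograms.
Definition evlE := (ev_cons, ev_head, ev_tail, ev_nth, ev_claim, ev_ppair, ev_pfst,
  ev_psnd, evE).

(* Environment of the justification programs: [:: a; e; xs; y; l]. *)
Definition varA := PProj 0.
Definition varE := PProj 1.
Definition varX := PProj 2.
Definition varY := PProj 3.
Definition varL := PProj 4.
Definition ppredcons t := app2 pcons (app1 ppred (app1 phead varX)) t.

Definition pcase2 := app2 peq varY (app2 pnth varA varX).
Definition pcase1 := app2 peq varY (app1 PSucc (app2 pnth PZero varX)).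
Definition pcase3 := app2 peq varY
  (app1 POrc (app2 padd (app2 pnth PZero varX) (app2 pnth PZero varX))).
Definition pcase4 := app2 pmul (app3 pclaim (app1 psnd varA) varX varL)
  (app3 pclaim (app1 pfst varA) varL varY).
Definition pcase0 := app2 peq varY PZero.
Definition pcase6 := app2 pmul
  (app2 peq varY (app2 pcons (app1 phead varY) (app1 ptail varY)))
  (app2 pmul (app3 pclaim (app1 pfst varA) varX (app1 phead varY))
    (app3 pclaim (app1 psnd varA) varX (app1 ptail varY))).
Definition pcase7 := app3 pif varX
  (app3 pif (app1 phead varX)
    (app2 pmul (app3 pclaim varE (ppredcons (app1 ptail varX)) varL)
      (app3 pclaim (app1 psnd varA) (ppredcons (app2 pcons varL (app1 ptail varX))) varY))
    (app3 pclaim (app1 pfst varA) (app1 ptail varX) varY))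
  PZero.
Definition pcase8 := app2 pmul (app3 pclaim varA (app2 pcons varY varX) PZero)
  (app3 pclaim (app2 ppair (pconst 9) varA) (app2 pcons varY varX) PZero).
Definition pcase9 := app3 pif (app1 phead varX)
    (app2 pmul (app3 pclaim varE (ppredcons (app1 ptail varX)) PZero)
      (app3 pclaim varA (ppredcons (app1 ptail varX)) (app1 PSucc varL)))
  (pconst 1).

Fixpoint pswitch (t : prf) (ps : seq prf) (d : prf) : prf :=
  if ps is p :: ps' then app3 pif t (pswitch (app1 ppred t) ps' d) p else d.

Lemma ev_switch C ps d (t : prf) xs :
  ev C (pswitch t ps d) xs = nth (ev C d xs) [seq ev C p xs | p <- ps] (ev C t xs).
Proof.
elim: ps t => [|p ps IH] t; first by rewrite nth_nil.
rewrite /pswitch ev_app3 ev_if -/(pswitch _ _ _) IH ev_app1 ev_pred /=.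
by case: (ev C t xs).
Qed.

Definition pjustified_at := pswitch (PProj 0)
  [seq PComp p [:: PProj 1; PProj 2; PProj 3; PProj 4; PProj 5] | p <-
    [:: pcase0; pcase1; pcase2; pcase3; pcase4; pcase0; pcase6; pcase7; pcase8]]
  (PComp pcase9 [:: PProj 1; PProj 2; PProj 3; PProj 4; PProj 5]).

Lemma ev_justified_at C t a e xs y l :
  ev C pjustified_at [:: t; a; e; xs; y; l] = justified_at C t a e xs y l.
Proof.
rewrite ev_switch ev_PProj -map_comp.
set env := [:: a; e; xs; y; l].
have E p : ev C (PComp p [:: PProj 1; PProj 2; PProj 3; PProj 4; PProj 5])
  [:: t; a; e; xs; y; l] = ev C p env by [].
rewrite E (eq_map (g := fun p => ev C p env)) //.
have evp p q r : ev C p env = r -> q = ev C p env -> q = r by move=> <-.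
move: t {E} => [|[|[|[|[|[|[|[|[|t]]]]]]]]].
- by apply: (evp pcase0) => //; rewrite !evlE.
- by apply: (evp pcase1) => //; rewrite !evlE.
- by apply: (evp pcase2) => //; rewrite !evlE.
- by apply: (evp pcase3) => //; rewrite !evlE.
- by apply: (evp pcase4) => //; rewrite !evlE mulnb.
- by apply: (evp pcase0) => //; rewrite !evlE.
- by apply: (evp pcase6) => //; rewrite !evlE !mulnb.
- apply: (evp pcase7) => //; rewrite !evlE /=.
  by case: (xs == 0) => //; case: (_ == 0); rewrite ?mulnb.
- by apply: (evp pcase8) => //; rewrite !evlE !mulnb.
- apply: (evp pcase9); last by rewrite nth_default.
  by rewrite !evlE /=; case: (_ == 0); rewrite ?mulnb.
Qed.

Definition pjustified := PComp pjustified_at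
  [:: app1 pfst (app1 pfst (PProj 0)); app1 psnd (app1 pfst (PProj 0));
      app1 pfst (PProj 0); app1 pfst (app1 psnd (PProj 0));
      app1 psnd (app1 psnd (PProj 0)); PProj 1].

Lemma ev_justified C m l : ev C pjustified [:: m; l] = justified C m l.
Proof.
rewrite /pjustified; set gs := [:: _; _; _; _; _; _].
have -> : ev C (PComp pjustified_at gs) [:: m; l] =
  ev C pjustified_at [seq ev C g [:: m; l] | g <- gs] by [].
by rewrite /gs /map ev_justified_at !evlE.
Qed.

Definition puniv :=
  app2 pmul
    (app3 pclaim (app1 pfst (PProj 2))
      (app2 pcons (PProj 0) (app2 pcons (app1 pfst (PProj 1))
        (app2 pcons (app1 psnd (PProj 2)) PZero)))
      (pconst 1))
    (app3 pif (app1 POrc (app1 PSucc (app2 padd (PProj 0) (PProj 0))))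
      (app2 pjustified (PProj 0) (app1 psnd (PProj 1)))
      (pconst 1)).

Lemma Sigma11_univ : Sigma11 univ.
Proof.
exists univ_pred; split=> //.
apply: (primrec_recursive_pred (e := puniv)); first by vm_compute.
move=> C m l c; rewrite /puniv !(ev_justified, evlE) /univ_pred /=.
by case: (C _); rewrite /= ?mulnb ?muln1 ?andbT.
Qed.

(** * Languages of radius-one automata are Sigma11 *)

Definition ca (S : finType) (F : S -> S -> S -> S) (x : config S) : config S :=
  fun i : int => F (x (i - 1)%R) (x i) (x (i + 1)%R).

Lemma ca_cellular_automaton (S : finType) (F : S -> S -> S -> S) :
  cellular_automaton (ca F).
Proof.
split=> [x n|x].
  exists n.+1 => y xy i le_i.
  by rewrite /ca !xy //; lia.
by apply/funext => i; rewrite /ca /shift; congr F; congr x; lia.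
Qed.

(** * The integers folded onto the naturals *)

Definition znat (i : int) : nat := match i with Posz n => n.*2 | Negz n => n.*2.+1 end.
Definition natz (z : nat) : int := if odd z then Negz z./2 else Posz z./2.
(** The code 1 stands for -1; there the truncated [z.-2] gives 0, as it should. *)
Definition zsucc z := if odd z then z.-2 else z.+2.
Definition zpred z := if odd z then z.+2 else if z == 0 then 1 else z.-2.

Lemma znatK : cancel znat natz.
Proof. by case=> n; rewrite /natz /= odd_double ?doubleK //= uphalf_double. Qed.
Lemma natzK : cancel natz znat.
Proof.
move=> z; rewrite /natz -[RHS]odd_double_half; case: (odd z) => //=.
Qed.
Lemma znatS i : znat (i + 1)%R = zsucc (znat i).
Proof.
case: i => [n|[|n]] //.
  by rewrite (_ : (Posz n + 1)%R = Posz n.+1) /zsucc /= ?odd_double //; lia.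
by rewrite (_ : (Negz n.+1 + 1)%R = Negz n) /zsucc /= ?odd_double //; lia.
Qed.
Lemma znatP i : znat (i - 1)%R = zpred (znat i).
Proof.
case: i => [[|n]|n] //.
  by rewrite (_ : (Posz n.+1 - 1)%R = Posz n) /zpred /= ?odd_double //; lia.
by rewrite (_ : (Negz n - 1)%R = Negz n.+1) /zpred /= ?odd_double //; lia.
Qed.

Definition podd := PPrec PZero (app1 pnot (PProj 1)).
Definition pzsucc := app3 pif (app1 podd (PProj 0)) (app1 ppred ppred)
  (app1 PSucc PSucc).
Definition pzpred := app3 pif (app1 podd (PProj 0)) (app1 PSucc PSucc)
  (app3 pif (PProj 0) (app1 ppred ppred) (pconst 1)).

Fixpoint plookup (tb : seq nat) : prf :=
  if tb is v :: tb' then PPrec (pconst v) (app1 (plookup tb') (PProj 0)) else PZero.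

Section RulePrograms.
Variable C : nat -> bool.

Lemma ev_odd z : ev C podd [:: z] = odd z.
Proof.
elim: z => // z IH; rewrite /podd ev_PPrecS -/podd IH !evE /=.
by case: (odd z).
Qed.
Lemma ev_zsucc z : ev C pzsucc [:: z] = zsucc z.
Proof.
by rewrite /pzsucc !(ev_odd, evE) /= /zsucc; case: (odd z).
Qed.
Lemma ev_zpred z : ev C pzpred [:: z] = zpred z.
Proof.
by rewrite /pzpred !(ev_odd, evE) /= /zpred; case: (odd z).
Qed.
Lemma ev_lookup tb j : ev C (plookup tb) [:: j] = nth 0 tb j.
Proof.
elim: tb j => [|v tb IH] [|j] //; first by rewrite /plookup ev_PPrec0 evE.
by rewrite /plookup ev_PPrecS -/(plookup _) !evE /= IH.
Qed.
End RulePrograms.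

Lemma primrec_lookup tb : primrec 1 (plookup tb).
Proof. by elim: tb => //= v tb ->; rewrite primrec_const. Qed.

Section LanguageSigma11.
Variables (S : finType) (s0 : S) (F : S -> S -> S -> S).
Local Notation N := #|S|.
Definition letter (j : nat) : S := nth s0 (enum S) j.
Definition rank (s : S) : nat := enum_rank s.

Lemma rankK s : letter (rank s) = s.
Proof. exact: nth_enum_rank. Qed.
Lemma letterK j : j < N -> rank (letter j) = j.
Proof.
move=> ltj; rewrite /rank /letter.
have -> : nth s0 (enum S) j = enum_val (Ordinal ltj) by rewrite (enum_val_nth s0).
by rewrite enum_valK.
Qed.
Lemma rank_lt s : rank s < N. Proof. exact: ltn_ord. Qed.

Definition rule_table : seq nat :=
  mkseq (fun j => rank (F (letter (j %% N)) (letter (j %/ N %% N)) (letter (j %/ N %/ N))))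
    (N * (N * N)).

Lemma nth_rule_table a b c : a < N -> b < N -> c < N ->
  nth 0 rule_table (a + N * (b + N * c)) = rank (F (letter a) (letter b) (letter c)).
Proof.
move=> lta ltb ltc; rewrite nth_mkseq; last by nia.
have N0 : 0 < N by lia.
have E x y : x < N -> (x + N * y) %% N = x /\ (x + N * y) %/ N = y.
  by move=> ltx; rewrite (mulnC N) addnC modnMDl divnMDl // modn_small // divn_small // addn0.
by rewrite (E _ _ lta).1 (E _ _ lta).2 (E _ _ ltb).1 (E _ _ ltb).2.
Qed.

Section Diagram.
Variable C : nat -> bool.

(* The oracle describes a space-time diagram: the letter at time k and position *)
(* z has as rank the number of true bits among N - 1, so every oracle is valid. *)
Definition cell_rank (k z : nat) : nat :=
  iteri N.-1 (fun i r => r + C (cantor (cantor k z) i)) 0.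

Definition rule_check m :=
  let k := fst_of m in let z := snd_of m in
  cell_rank k.+1 z == nth 0 rule_table
    (cell_rank k (zpred z) + N * (cell_rank k z + N * cell_rank k (zsucc z))).

Definition return_check k m :=
  iteri m (fun i r => r * (cell_rank k i == cell_rank 0 i)) 1 == 1.

(** [code_word] is a right fold, so step i adds the letter at position k - i - 1, whose integer code
    is twice that number. *)
Definition prefix_code k :=
  iteri k (fun i r => (cell_rank 0 (k - i).-1.*2).+1 + N * r) 0.

(** One universal variable plays three parts: the space-time cell to check, the lower bound on the
    return time and the size of the window. [l] pairs the return time with the length of the
    word. *)
Definition lang_pred (m l c : nat) : bool :=
  rule_check m && ((m <= fst_of l) && (return_check (fst_of l) m
    && (c == prefix_code (snd_of l)))).

Definition pcell_rec := PPrec PZero (app2 padd (PProj 1)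
  (app1 POrc (app2 ppair (app2 ppair (PProj 2) (PProj 3)) (PProj 0)))).
Definition pcell := app3 pcell_rec (pconst N.-1) (PProj 0) (PProj 1).

Definition prule := app2 peq
  (app2 pcell (app1 PSucc (app1 pfst (PProj 0))) (app1 psnd (PProj 0)))
  (app1 (plookup rule_table)
    (app2 padd (app2 pcell (app1 pfst (PProj 0)) (app1 pzpred (app1 psnd (PProj 0))))
      (app2 pmul (pconst N)
        (app2 padd (app2 pcell (app1 pfst (PProj 0)) (app1 psnd (PProj 0)))
        (app2 pmul (pconst N)
          (app2 pcell (app1 pfst (PProj 0)) (app1 pzsucc (app1 psnd (PProj 0))))))))).

Definition preturn_rec := PPrec (pconst 1) (app2 pmul (PProj 1)
  (app2 peq (app2 pcell (PProj 2) (PProj 0)) (app2 pcell PZero (PProj 0)))).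

Definition pprefix_rec := PPrec PZero (app2 padd
  (app1 PSucc (app2 pcell PZero
     (app2 padd (app1 ppred (app2 psub (PProj 2) (PProj 0)))
       (app1 ppred (app2 psub (PProj 2) (PProj 0))))))
  (app2 pmul (pconst N) (PProj 1))).

Lemma ev_cell k z : ev C pcell [:: k; z] = cell_rank k z.
Proof.
rewrite /pcell ev_app3 !evE -[[:: _; _; _]]/[:: N.-1; k; z] /cell_rank.
elim: N.-1 => // n IH.
by rewrite /pcell_rec ev_PPrecS -/pcell_rec IH !(ev_ppair, evE).
Qed.

Lemma ev_rule m : ev C prule [:: m] = rule_check m.
Proof.
by rewrite /prule !(ev_cell, ev_zsucc, ev_zpred, ev_pfst, ev_psnd, ev_lookup, evE).
Qed.

Lemma ev_return_rec m k : ev C preturn_rec [:: m; k] =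
  iteri m (fun i r => r * (cell_rank k i == cell_rank 0 i)) 1.
Proof.
elim: m => // m IH.
by rewrite /preturn_rec ev_PPrecS -/preturn_rec IH !(ev_cell, evE).
Qed.

Lemma ev_prefix_rec j k : ev C pprefix_rec [:: j; k] =
  iteri j (fun i r => (cell_rank 0 (k - i).-1.*2).+1 + N * r) 0.
Proof.
elim: j => // j IH.
by rewrite /pprefix_rec ev_PPrecS -/pprefix_rec IH !(ev_cell, evE) /= addnn.
Qed.

Definition plang :=
  app2 pmul (app1 prule (PProj 0))
  (app2 pmul (app2 pleq (PProj 0) (app1 pfst (PProj 1)))
  (app2 pmul (app2 peq (app2 preturn_rec (PProj 0) (app1 pfst (PProj 1))) (pconst 1))
    (app2 peq (PProj 2) (app2 pprefix_rec (app1 psnd (PProj 1)) (app1 psnd (PProj 1)))))).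

Lemma ev_lang m l c : ev C plang [:: m; l; c] = lang_pred m l c.
Proof.
by rewrite /plang !(ev_rule, ev_return_rec, ev_prefix_rec, ev_pfst, ev_psnd, evE) !mulnb.
Qed.
End Diagram.

Lemma primrec_plang : primrec 3 plang.
Proof. by rewrite /= !primrec_const primrec_lookup; vm_compute. Qed.

Section Spacetime.
Variable C : nat -> bool.
Hypothesis check : forall m, rule_check C m.
Let y : config S := fun i => letter (cell_rank C 0 (znat i)).

Lemma cell_rank_lt k z : cell_rank C k z < N.
Proof.
have N0 : 0 < N by apply/card_gt0P; exists s0.
suff le_rank : cell_rank C k z <= N.-1 by rewrite -(prednK N0) ltnS.
rewrite /cell_rank; elim: N.-1 => // n IH.
by rewrite [iteri _ _ _]/=; case: (C _); lia.
Qed.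

Lemma iter_diagram k i : iter k (ca F) y i = letter (cell_rank C k (znat i)).
Proof.
elim: k i => // k IH i; rewrite iterS {1}/ca !IH.
have /eqP := check (cantor k (znat i)); rewrite !pairK.
rewrite nth_rule_table ?cell_rank_lt // => ->.
by rewrite rankK znatP znatS.
Qed.

Lemma prefix_code_diagram k : prefix_code C k = code_word (mkseq (fun i => y (Posz i)) k).
Proof.
set w := mkseq _ k.
have szw : size w = k by rewrite size_mkseq.
suff H j : j <= k -> iteri j (fun i r => (cell_rank C 0 (k - i).-1.*2).+1 + N * r) 0 =
    code_word (drop (k - j) w) by rewrite [LHS]H // subnn drop0.
elim: j => [|j IH] ltj; first by rewrite subn0 drop_oversize ?szw.
rewrite [LHS]/= IH; last exact: ltnW.
rewrite [in RHS](drop_nth s0) ?szw; last by lia.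
rewrite (_ : (k - j.+1).+1 = k - j); last by lia.
rewrite /= nth_mkseq; last by lia.
rewrite -/(rank _) letterK ?cell_rank_lt //.
by rewrite (_ : (k - j).-1 = k - j.+1) //; lia.
Qed.
End Spacetime.

Lemma return_checkP C k m :
  reflect (forall z, z < m -> cell_rank C k z = cell_rank C 0 z) (return_check C k m).
Proof.
rewrite /return_check; elim: m => [|m IH] /=; first by apply: ReflectT.
rewrite muln_eq1 eqb1; apply: (iffP andP) => [[/IH H E] z|H].
  by rewrite ltnS leq_eqVlt => /predU1P[->|/H //]; apply/eqP.
by rewrite H // eqxx; split=> //; apply/IH => z ltz; apply: H; apply: ltnW.
Qed.

Theorem Sigma11_language : Sigma11 (language (nonwandering (ca F))).
Proof.
exists lang_pred; split.
  by apply: (primrec_recursive_pred primrec_plang) => C m l w; apply: ev_lang.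
move=> c; split=> [[y [rec_y [k0 Ec]]]|[C HC]].
  (* Bit number i of a cell is set when i is below the rank of its letter, so the [N.-1] bits add up
     to the rank. *)
  pose C j := snd_of j < rank (iter (fst_of (fst_of j)) (ca F) y (natz (snd_of (fst_of j)))).
  have rankC k i : cell_rank C k (znat i) = rank (iter k (ca F) y i).
    rewrite /cell_rank; have := rank_lt (iter k (ca F) y i).
    set a := rank _ => lta; suff H n : iteri n (fun i0 r => r + C (cantor (cantor k (znat i)) i0)) 0
      = minn n a by rewrite H; lia.
    elim: n => [|n IH]; first by rewrite min0n.
    by rewrite [iteri _ _ _]/= IH /C !pairK znatK -/a; lia.
  have check m : rule_check C m.
    rewrite /rule_check -[snd_of m]natzK -znatP -znatS !rankC.
    by rewrite nth_rule_table ?rank_lt // !rankK.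
  exists C => m; have [y' [[k lek ->] agr]] := rec_y m m.
  exists (cantor k k0); rewrite /lang_pred check !pairK lek /=; apply/andP; split.
    apply/return_checkP => z ltz; rewrite -[z]natzK !rankC; congr rank.
    rewrite [RHS]agr //; rewrite /natz; case: (odd z); lia.
  rewrite Ec prefix_code_diagram //; apply/eqP; congr (code_word (mkseq _ k0)).
  by apply/funext => i; rewrite (rankC 0) rankK.
have check m : rule_check C m by have [l /andP[]] := HC m.
exists (fun i => letter (cell_rank C 0 (znat i))); split; last first.
  have [l /and4P[_ _ _ /eqP->]] := HC 0; exists (snd_of l).
  exact: prefix_code_diagram.
(* Integers of absolute value at most m have codes at most 2m, so this bound covers both the window
   and the return time. *)
move=> n m; have [l /and4P[_ lel /return_checkP ret _]] := HC (maxn n m.*2.+2).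
exists (iter (fst_of l) (ca F) (fun i => letter (cell_rank C 0 (znat i)))); split.
  by exists (fst_of l) => //; lia.
move=> i lei; rewrite iter_diagram // ret //.
by case: i lei => i /=; lia.
Qed.
End LanguageSigma11.

(** * A while language and a compiler into it *)

Inductive cmd : Type :=
| Skip | Inc of nat | Dec of nat | Orc of nat | Seq of cmd & cmd | While of nat & cmd.

Definition regs := nat -> nat.
Definition upd (s : regs) r v : regs := fun i => if i == r then v else s i.

Lemma upd_upd s r v w : upd (upd s r v) r w = upd s r w.
Proof. by apply/funext => i; rewrite /upd; case: eqP. Qed.
Lemma upd_id s r : upd s r (s r) = s.
Proof. by apply/funext => i; rewrite /upd; case: eqP => // ->. Qed.

Inductive exec (D : nat -> bool) : cmd -> regs -> regs -> Prop :=
| ex_skip s : exec D Skip s s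
| ex_inc r s : exec D (Inc r) s (upd s r (s r).+1)
| ex_dec r s : exec D (Dec r) s (upd s r (s r).-1)
| ex_orc r s : exec D (Orc r) s (upd s r (D (s r)))
| ex_seq c d s1 s2 s3 : exec D c s1 s2 -> exec D d s2 s3 -> exec D (Seq c d) s1 s3
| ex_while0 r c s : s r = 0 -> exec D (While r c) s s
| ex_whileS r c s1 s2 s3 : s1 r <> 0 -> exec D c s1 s2 -> exec D (While r c) s2 s3 ->
    exec D (While r c) s1 s3.

Definition clear r := While r (Dec r).
(** The first loop empties [x]; the second restores it from the spare copy in [t]. *)
Definition copy x o t :=
  Seq (clear o) (Seq (clear t)
    (Seq (While x (Seq (Dec x) (Seq (Inc o) (Inc t)))) (While t (Seq (Dec t) (Inc x))))).
Definition load i (xs : seq nat) o n := if i < size xs then copy (nth 0 xs i) o n else clear o.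

Definition compile_list (compile : prf -> seq nat -> nat -> nat -> cmd) xs m :=
  fix comps gs j := if gs is g :: gs' then Seq (compile g xs j m) (comps gs' j.+1) else Skip.

(** [xs] are the argument registers, [o] the output, and everything from [n] on is scratch. In a
    recursion [n] is the index, [n.+1] the current value, [n.+2] the number of rounds left and
    [n.+3] the next value; in a minimisation [n] is the candidate and [n.+1] its value. *)
Fixpoint compile (e : prf) (xs : seq nat) (o n : nat) : cmd :=
  match e with
  | PZero => clear o
  | PSucc => Seq (load 0 xs o n) (Inc o)
  | PProj i => load i xs o n
  | POrc => Seq (load 0 xs o n) (Orc o)
  | PComp f gs =>
      let m := n + size gs in
      Seq (compile_list compile xs m gs n)
          (compile f (iota n (size gs)) o m)
  | PPrec f g =>
      if xs is x :: xs' then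
        Seq (copy x n.+2 n.+4) (Seq (clear n) (Seq (compile f xs' n.+1 n.+4)
          (Seq (While n.+2 (Seq (Dec n.+2) (Seq (compile g [:: n, n.+1 & xs'] n.+3 n.+4)
                 (Seq (copy n.+3 n.+1 n.+4) (Inc n)))))
          (copy n.+1 o n.+4))))
      else Skip
  | PMu f =>
      Seq (clear n) (Seq (compile f (n :: xs) n.+1 n.+2)
        (Seq (While n.+1 (Seq (Inc n) (compile f (n :: xs) n.+1 n.+2))) (copy n o n.+2)))
  end.

(** * Correctness of the compiler *)

Section CompileCorrect.
Variable D : nat -> bool.
Notation exec := (exec D).

Lemma exec_clear r s : exec (clear r) s (upd s r 0).
Proof.
move E : (s r) => k; elim: k s E => [|k IH] s E.
  by rewrite -E upd_id; apply: ex_while0.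
apply: ex_whileS (ex_dec _ _ _) _; first by rewrite E.
by rewrite -(upd_upd s r (s r).-1 0); apply: IH; rewrite /upd eqxx E.
Qed.

Lemma exec_while_dec r c (I : nat -> regs -> Prop) :
  (forall k s, s r = k.+1 -> I k.+1 s -> exists s', [/\ exec c s s', s' r = k & I k s']) ->
  forall k s, s r = k -> I k s -> exists s', [/\ exec (While r c) s s', s' r = 0 & I 0 s'].
Proof.
move=> step; elim=> [|k IH] s E Is; first by exists s; split=> //; apply: ex_while0.
have [s1 [E1 r1 I1]] := step _ _ E Is; have [s2 [E2 r2 I2]] := IH _ r1 I1.
by exists s2; split=> //; apply: ex_whileS E1 E2; rewrite E.
Qed.

Lemma exec_copy x o t s : x != o -> x != t -> o != t ->
  exists s', [/\ exec (copy x o t) s s', s' o = s x &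
    forall i, i != o -> i != t -> s' i = s i].
Proof.
move=> xo xt ot; set s1 := upd (upd s o 0) t 0.
have [|||s2 [E2 x2 [o2 t2 H2]]] := @exec_while_dec x (Seq (Dec x) (Seq (Inc o) (Inc t)))
    (fun k s' => [/\ s' o + k = s x, s' t + k = s x &
      forall i, i != o -> i != t -> i != x -> s' i = s i]) _ (s x) s1.
- move=> k s' E [Ho Ht H]; eexists; split.
  + by apply: ex_seq (ex_dec _ _ _) _; apply: ex_seq (ex_inc _ _ _) (ex_inc _ _ _).
  + by rewrite /upd (negPf xo) (negPf xt) eqxx E.
  + split.
    * rewrite /upd eqxx (negPf ot) eq_sym (negPf xo); lia.
    * rewrite /upd eqxx ![t == _]eq_sym (negPf ot) (negPf xt); lia.
    * by move=> i io it ix; rewrite /upd (negPf io) (negPf it) (negPf ix) H.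
- by rewrite /s1 /upd (negPf xo) (negPf xt).
- split; rewrite /s1 /upd ?eqxx ?(negPf ot) //.
  by move=> i io it ix; rewrite (negPf io) (negPf it).
have [|||s3 [E3 t3 [o3 x3 H3]]] := @exec_while_dec t (Seq (Dec t) (Inc x))
    (fun k s' => [/\ s' o = s x, s' x + k = s x &
      forall i, i != o -> i != t -> i != x -> s' i = s i]) _ (s2 t) s2.
- move=> k s' E [Ho Hx H]; eexists; split.
  + by apply: ex_seq (ex_dec _ _ _) (ex_inc _ _ _).
  + by rewrite /upd eq_sym (negPf xt) eqxx E.
  + split.
    * by rewrite /upd eq_sym (negPf xo) (negPf ot).
    * rewrite /upd eqxx (negPf xt); lia.
    * by move=> i io it ix; rewrite /upd (negPf it) (negPf ix) H.
- by [].
- by split=> //; lia.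
exists s3; split=> //.
  do 2![apply: ex_seq (exec_clear _ _) _]; exact: ex_seq E2 E3.
by move=> i io it; have [->|ix] := eqVneq i x; [lia|exact: H3].
Qed.

Lemma exec_load i xs o n s : all (ltn^~ n) xs -> o < n -> o \notin xs ->
  exists s', [/\ exec (load i xs o n) s s', s' o = nth 0 [seq s x | x <- xs] i &
    forall i, i < n -> i != o -> s' i = s i].
Proof.
move=> xs_n on oxs; rewrite /load; case: ifP => [lti|/negbT]; last first.
  rewrite -leqNgt => gei; exists (upd s o 0); split; first exact: exec_clear.
    by rewrite /upd eqxx nth_default ?size_map.
  by move=> j _ /negPf jo; rewrite /upd jo.
have xin : nth 0 xs i \in xs by rewrite mem_nth.
have xn : nth 0 xs i < n by apply: (allP xs_n).
have [|||s' [E so H]] := @exec_copy (nth 0 xs i) o n s.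
- by apply: contraNneq oxs => <-.
- by rewrite neq_ltn xn.
- by rewrite neq_ltn on.
exists s'; split=> //; first by rewrite so (nth_map 0).
by move=> j jn jo; apply: H => //; rewrite neq_ltn jn.
Qed.

Lemma map_regs (s s' : regs) xs n : all (ltn^~ n) xs -> (forall i, i < n -> s' i = s i) ->
  [seq s' x | x <- xs] = [seq s x | x <- xs].
Proof. by move=> /allP xs_n H; apply/eq_in_map => x /xs_n; apply: H. Qed.

Lemma all_ltnW n m xs : n <= m -> all (ltn^~ n) xs -> all (ltn^~ m) xs.
Proof. by move=> nm; apply: sub_all => x /leq_trans; apply. Qed.

Lemma notin_ltn n m xs : n <= m -> all (ltn^~ n) xs -> m \notin xs.
Proof. by move=> nm /allP xs_n; apply/negP => /xs_n; rewrite /= ltnNge nm. Qed.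

(** Turns the nested derivation into the sequence of values that the compiled loop runs through. *)
Lemma evalp_prec_inv f g n xs y : evalp D (PPrec f g) (n :: xs) y ->
  exists v : nat -> nat, [/\ evalp D f xs (v 0),
    forall k, k < n -> evalp D g [:: k, v k & xs] (v k.+1) & v n = y].
Proof.
elim: n y => [|n IH] y H; inversion H as [ | | | | |? ? ? ? Hf|? ? ? ? r ? Hr Hg| ]; subst.
  by exists (fun _ => y).
have [v [v0 vS vn]] := IH _ Hr.
exists (fun k => if k <= n then v k else y); split=> //; last by rewrite ltnn.
move=> k; rewrite ltnS => lek; rewrite lek; case: (ltnP k n) => [|gek]; first exact: vS.
by rewrite (_ : k = n) ?vn //; lia.
Qed.

(** The frame clause makes nesting possible: a call may spoil only its output and the registers from
    [n] on. *)
Lemma exec_compile e xs o n s y :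
  all (ltn^~ n) xs -> o < n -> o \notin xs -> evalp D e [seq s x | x <- xs] y ->
  exists s', [/\ exec (compile e xs o n) s s', s' o = y &
    forall i, i < n -> i != o -> s' i = s i].
Proof.
elim/prf_nested_ind: e xs o n s y => [||j|| f gs IHf IHgs | f g IHf IHg | f IHf]
  xs o n s y xs_n on oxs H.
- inversion H; subst; exists (upd s o 0); split; first exact: exec_clear.
    by rewrite /upd eqxx.
  by move=> i _ /negPf io; rewrite /upd io.
- inversion H; subst; have [s' [E so Hs]] := exec_load 0 s xs_n on oxs.
  eexists; split; first exact: ex_seq E (ex_inc _ _ _).
    by rewrite /upd eqxx so.
  by move=> i lti io; rewrite /upd (negPf io) Hs.
- by inversion H; subst; apply: exec_load.
- inversion H; subst; have [s' [E so Hs]] := exec_load 0 s xs_n on oxs.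
  eexists; split; first exact: ex_seq E (ex_orc _ _ _).
    by rewrite /upd eqxx so.
  by move=> i lti io; rewrite /upd (negPf io) Hs.
- inversion H as [ | | | |f1 gs1 xs1 ys y1 Hgs Hf | | | ]; subst => /=.
  set m := n + size gs; set comps := compile_list compile xs m.
  have list gs' j s0 ys' : All (fun g => forall xs o n s y, all (ltn^~ n) xs -> o < n ->
      o \notin xs -> evalp D g [seq s x | x <- xs] y ->
      exists s', [/\ exec (compile g xs o n) s s', s' o = y &
        forall i, i < n -> i != o -> s' i = s i]) gs' ->
      n <= j -> j + size gs' <= m -> evall D gs' [seq s0 x | x <- xs] ys' ->
      exists s1, [/\ exec (comps gs' j) s0 s1,
      [seq s1 x | x <- iota j (size gs')] = ys' & forall i, i < j -> s1 i = s0 i].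
    elim: gs' j s0 ys' => [|g gs' IH] j s0 ys'.
      by move=> _ _ _ H'; inversion H'; exists s0; split=> //; apply: ex_skip.
    move=> /= [IHg IHgs'] nj jm H'.
    inversion H' as [|g1 gs1 xs1 y1 ys1 Hg Hgs1]; subst.
    have jm' : j < m by lia.
    have [s1 [E1 y1E H1]] := IHg _ _ _ _ _ (all_ltnW (leq_trans nj (ltnW jm')) xs_n) jm'
      (notin_ltn nj xs_n) Hg.
    have Hgs2 : evall D gs' [seq s1 x | x <- xs] ys1.
      rewrite (map_regs xs_n (s := s0)) // => i lti; apply: H1; first by lia.
      by rewrite neq_ltn (leq_trans lti nj).
    have [|s2 [E2 ysE H2]] := IH j.+1 s1 ys1 IHgs' (leqW nj) _ Hgs2; first by lia.
    exists s2; split; first exact: ex_seq E1 E2.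
      by rewrite ysE H2 // y1E.
    move=> i lti; rewrite H2; last by lia.
    by apply: H1; [lia | rewrite neq_ltn lti].
  have [s1 [E1 ysE H1]] := list gs n s ys IHgs (leqnn _) (leqnn _) Hgs.
  have [||||s2 [E2 so H2]] := IHf (iota n (size gs)) o m s1 y.
  - by apply/allP => x; rewrite mem_iota => /andP[].
  - by lia.
  - by rewrite mem_iota negb_and -ltnNge on.
  - by rewrite ysE.
  exists s2; split=> //; first exact: ex_seq E1 E2.
  by move=> i lti io; rewrite H2 ?H1 //; lia.
- case: xs xs_n oxs H => [|x xs] xs_n oxs H; first by inversion H.
  have [v [v0 vS vn]] := evalp_prec_inv H; rewrite {H} /=.
  move: xs_n oxs => /= /andP[xn xs_n]; rewrite inE negb_or => /andP[ox oxs].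
  have [|||s1 [E1 s1x H1]] := @exec_copy x n.+2 n.+4 s; try lia.
  set s2 := upd s1 n 0.
  have xs_n4 : all (ltn^~ n.+4) xs by apply: all_ltnW xs_n; lia.
  have s2xs : [seq s2 x | x <- xs] = [seq s x | x <- xs].
    apply: map_regs xs_n _ => i lti.
    by rewrite /s2 /upd ifN ?H1 //; lia.
  have [|||s3 [E3 s3v H3]] := IHf xs n.+1 n.+4 s2 (v 0) xs_n4;
    rewrite ?s2xs //; [by lia|by apply: notin_ltn xs_n; lia|].
  (* With k rounds left, the loop has reached entry [s x - k] of the sequence [v]. *)
  pose I k s' := [/\ k <= s x, s' n = s x - k, s' n.+1 = v (s x - k) &
    forall i, i < n -> s' i = s i].
  have [| | |s4 [E4 _ [_ s4n s4v H4]]] := @exec_while_dec n.+2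
    (Seq (Dec n.+2) (Seq (compile g [:: n, n.+1 & xs] n.+3 n.+4)
                 (Seq (copy n.+3 n.+1 n.+4) (Inc n)))) I _ (s x) s3.
  - move=> k t tk [lek tn tv Ht]; set t1 := upd t n.+2 (t n.+2).-1.
    have [||||t2 [F2 t2v G2]] := IHg [:: n, n.+1 & xs] n.+3 n.+4 t1 (v (s x - k)).
    + by rewrite /= xs_n4 andbT; apply/andP; split; lia.
    + by lia.
    + by rewrite !inE (negPf (notin_ltn _ xs_n)) ?orbF ; lia.
    + have -> : [seq t1 x | x <- [:: n, n.+1 & xs]] =
        [:: s x - k.+1, v (s x - k.+1) & [seq s x | x <- xs]].
        rewrite /= {1 2}/t1 {1 2}/upd !ifN ?tn ?tv; try lia.
        do 2!congr cons; apply: map_regs xs_n _ => i lti.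
        by rewrite /t1 /upd ifN ?Ht //; lia.
      by have := vS (s x - k.+1); rewrite -subSn // subSS; apply; lia.
    have [|||t3 [F3 t3v G3]] := @exec_copy n.+3 n.+1 n.+4 t2; try lia.
    exists (upd t3 n (t3 n).+1); split.
    + by apply: ex_seq (ex_dec _ _ _) _; apply: ex_seq F2 _; apply: ex_seq F3 (ex_inc _ _ _).
    + rewrite /upd ifN ?G3 ?G2; try lia.
      by rewrite /t1 /upd eqxx tk.
    + split; first by lia.
      * rewrite /upd eqxx G3 ?G2; try lia.
        rewrite /t1 /upd ifN ?tn; lia.
      * by rewrite /upd ifN ?t3v ?t2v //; lia.
      * move=> i lti; rewrite /upd ifN ?G3 ?G2; try lia.
        by rewrite /t1 /upd ifN ?Ht //; lia.
  - by rewrite H3 /s2 /upd ?ifN ?s1x //; lia.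
  - rewrite /I subnn s3v; split=> //.
      by rewrite H3 /s2 /upd ?eqxx //; lia.
    by move=> i lti; rewrite H3 /s2 /upd ?ifN ?H1 //; lia.
  have [|||s5 [E5 s5o H5]] := @exec_copy n.+1 o n.+4 s4; try lia.
  exists s5; split.
  + apply: ex_seq E1 _; apply: ex_seq (exec_clear _ _) _; apply: ex_seq E3 _.
    exact: ex_seq E4 E5.
  + by rewrite s5o s4v subn0.
  + by move=> i lti io; rewrite H5 ?H4 //; lia.
- inversion H as [ | | | | | | |f1 xs1 y1 H0 Hp]; subst => /=.
  set body := compile f (n :: xs) n.+1 n.+2.
  have run t z u : t n = z -> (forall i, i < n -> t i = s i) ->
      evalp D f (z :: [seq s x | x <- xs]) u ->
      exists t', [/\ exec body t t', t' n = z, t' n.+1 = u & forall i, i < n -> t' i = s i].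
    move=> tn Ht Hu; have [||||t' [F t'u G]] := IHf (n :: xs) n.+1 n.+2 t u.
    - by rewrite /= ltnS leqnSn (all_ltnW _ xs_n) //; lia.
    - by [].
    - by rewrite inE (negPf (notin_ltn _ xs_n)) ?orbF; lia.
    - by rewrite /= tn (map_regs xs_n Ht).
    exists t'; split=> //; first by rewrite G ?tn //; lia.
    by move=> i lti; rewrite G ?Ht //; lia.
  (* [d] is the distance to the minimum; the tested register [n.+1] vanishes exactly when [d]
     does. *)
  have loop d t z : z + d = y -> t n = z -> (forall i, i < n -> t i = s i) ->
      evalp D f (z :: [seq s x | x <- xs]) (t n.+1) ->
      (d = 0 -> t n.+1 = 0) -> (0 < d -> 0 < t n.+1) ->
      exists t', [/\ exec (While n.+1 (Seq (Inc n) body)) t t', t' n = y &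
        forall i, i < n -> t' i = s i].
    elim: d t z => [|d IH] t z Ez tn Ht tv td0 tdS.
      by exists t; split=> //; [apply: ex_while0; apply: td0 | lia].
    have [u Hu ud] : exists2 u, evalp D f (z.+1 :: [seq s x | x <- xs]) u &
        (d = 0 -> u = 0) /\ (0 < d -> 0 < u).
      case: (posnP d) => d0.
        by exists 0; [rewrite (_ : z.+1 = y) //; lia | split=> //; lia].
      by have [|u Hu] := Hp z.+1; [lia|exists u.+1 => //; split=> //; lia].
    have [||t1 [F1 t1n t1u G1]] := run (upd t n (t n).+1) z.+1 u _ _ Hu.
    - by rewrite /upd eqxx tn.
    - by move=> i lti; rewrite /upd ifN ?Ht //; lia.
    have [||||||t2 [F2 t2n G2]] := IH t1 z.+1; rewrite ?t1u //; [lia|by case: ud|by case: ud|].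
    exists t2; split=> //; apply: ex_whileS F2; first by have := tdS isT; lia.
    exact: ex_seq (ex_inc _ _ _) F1.
  have [u Hu ud] : exists2 u, evalp D f (0 :: [seq s x | x <- xs]) u &
        (y = 0 -> u = 0) /\ (0 < y -> 0 < u).
    case: (posnP y) => y0; first by exists 0; [rewrite -{1}y0 | split=> //; lia].
    by have [|u Hu] := Hp 0; [lia|exists u.+1 => //; split=> //; lia].
  have [||s1 [E1 s1n s1u H1]] := run (upd s n 0) 0 u _ _ Hu.
  - by rewrite /upd eqxx.
  - by move=> i lti; rewrite /upd ifN //; lia.
  have [||||||s2 [E2 s2n H2]] := loop y s1 0; rewrite ?s1u //; [by case: ud|by case: ud|].
  have [|||s3 [E3 s3o H3]] := @exec_copy n o n.+2 s2; try lia.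
  exists s3; split; last by move=> i lti io; rewrite H3 ?H2 //; lia.
    apply: ex_seq (exec_clear _ _) _; apply: ex_seq E1 _; exact: ex_seq E2 E3.
  by rewrite s3o.
Qed.
End CompileCorrect.

(** * A Turing head inside a cellular automaton *)

Section HeadAutomaton.
Variables (Q A : finType).
Variables (delta : Q -> bool -> A -> Q * A * option bool) (compat : rel A).

(* A cell carries an origin flag, a tape letter, and either the head in some    *)
(* state or the side on which the head lies (true: right).  Some None is the    *)
(* blank left of the origin, and None an error, which spreads.                  *)
Definition cell : finType := (bool * A * (Q + bool))%type.
Definition letters : finType := option (option cell).

(** Along the half-line the marks [inr true] may be followed by a head, and after a head or an
    [inr false] only [inr false] is possible, so two heads cannot coexist. The origin flag occurs
    exactly at the right end of the blank. *)
Definition coherent (x y : option cell) : bool :=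
  match x, y with
  | None, None => true
  | None, Some (o, _, h) => o && (h != inr false)
  | Some _, None => false
  | Some (_, a, h), Some (o', a', h') =>
      [&& ~~ o', compat a a' & if h == inr true then h' != inr false else h' == inr false]
  end.

Definition arrive (d : option bool) (n : option cell) (stay : Q + bool) : Q + bool :=
  if n is Some (o, a, inl q) then
    let: (q', _, d') := delta q o a in if d' == d then inl q' else stay
  else stay.

(** A departing head leaves its direction behind as the side mark, and no other mark changes except
    where the head arrives. *)
Definition next_cell (x y z : option cell) : option cell :=
  if y is Some (o, a, h) then
    match h with
    | inl q =>
        let: (q', a', d) := delta q o a in
        Some (o, a', if d is Some b then inr b else inl q')
    | inr true => Some (o, a, arrive (Some false) z h)
    | inr false => Some (o, a, arrive (Some true) x h)
    end
  else None.

Definition head_rule (x y z : letters) : letters :=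
  if (x, y, z) is (Some x', Some y', Some z') then
    if coherent x' y' && coherent y' z' then Some (next_cell x' y' z') else None
  else None.

Definition enc (q : Q) (p : nat) (T : nat -> A) : config letters := fun i =>
  if i is Posz n then
    Some (Some (n == 0, T n, if n < p then inr true else if n == p then inl q else inr false))
  else Some None.

Definition move (d : option bool) (p : nat) : nat :=
  if d is Some b then if b then p.+1 else p.-1 else p.

Lemma ca_enc q p T q' a' d :
  (forall n, compat (T n) (T n.+1)) -> delta q (p == 0) (T p) = (q', a', d) ->
  (p = 0 -> d <> Some false) ->
  ca head_rule (enc q p T) = enc q' (move d p) (fun n => if n == p then a' else T n).
Proof.
move=> cT E dp; apply/funext => -[[|n]|n]; rewrite /ca.
- rewrite (_ : (Posz 0 - 1)%R = Negz 0) // (_ : (Posz 0 + 1)%R = Posz 1) //.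
  case: p E dp => [|[|p]] E dp; rewrite /head_rule /= cT /=.
  + by rewrite E; case: d dp {E} => [[]|] /= dp //; case: (dp erefl).
  + by rewrite E; case: d {E dp} => [[]|].
  + by case: d {E dp} => [[]|].
- have -> : (Posz n.+1 - 1)%R = Posz n by lia.
  have -> : (Posz n.+1 + 1)%R = Posz n.+2 by lia.
  rewrite /head_rule /= !cT /=.
  case: (ltngtP n.+1 p) => [ltp|gtp|Ep].
  + have [Ep|np] := eqVneq p n.+2.
      subst p; rewrite ltnn E /=.
      by case: d {E dp} => [[]|]; rewrite /= ?ltnn ?eqxx ?ltnSn // ltnS leqnSn.
    have -> : n.+2 < p by lia.
    have -> : n.+1 < move d p by case: d {E dp} => [[]|] /=; lia.
    by [].
  + have [Ep|np] := eqVneq n p.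
      subst p; rewrite ltnNge leqW //= E /=.
      have -> : (n.+2 == n) = false by lia.
      case: d {E dp} => [[]|] /=; first by rewrite ltnn eqxx.
        by have [-> ->] : (n.+1 < n.-1) = false /\ (n.+1 == n.-1) = false by lia.
      by have [-> ->] : (n.+1 < n) = false /\ (n.+1 == n) = false by lia.
    have [-> ->] : (n.+2 < p) = false /\ (n.+2 == p) = false by lia.
    have [-> ->] : (n.+1 < move d p) = false /\ (n.+1 == move d p) = false.
      by case: d {E dp} => [[]|] /=; lia.
    by [].
  + subst p; rewrite [n.+2 < _]ltnNge leqnSn [n.+2 == _]eqn_leq ltnn /= E.
    case: d {E dp} => [[]|] /=; first by rewrite ltnS leqnn.
      by have [-> ->] : (n.+1 < n) = false /\ (n.+1 == n) = false by lia.
    by rewrite ltnn eqxx.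
- rewrite (_ : (Negz n - 1)%R = Negz n.+1); last by lia.
  case: n => [|n]; last by rewrite (_ : (Negz n.+1 + 1)%R = Negz n) //; lia.
  rewrite (_ : (Negz 0 + 1)%R = Posz 0) //=.
  by case: p {E dp} => [|p].
Qed.

(** The rule gives an error as soon as one of its three inputs is one, so errors persist and advance
    one cell per step in both directions. *)
Lemma error_spreads (x : config letters) k i j : x i = None -> `|i - j|%N <= k ->
  iter k (ca head_rule) x j = None.
Proof.
elim: k x i => [|k IH] x i xi le_ij; first by rewrite (_ : j = i) //; lia.
rewrite iterSr; have [E|[lt|gt]] : i = j \/ (i < j)%R \/ (j < i)%R by lia.
- by apply: (IH _ i); [rewrite /ca xi; case: (x _) | lia].
- by apply: (IH _ (i + 1)%R); [rewrite /ca GRing.addrK xi; case: (x _) | lia].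
- apply: (IH _ (i - 1)%R); last by lia.
  by rewrite /ca GRing.subrK xi /head_rule; case: (x _) => //; case: (x _).
Qed.

Section Recurrent.
Variable y : config letters.
Hypotheses (rec_y : nonwandering (ca head_rule) y) (y0 : y 0%R <> None).

(** An error at i would reach the origin within [|i|] steps and stay there, against a later return
    to a correct letter. Stating this one step after [y] gives the coherence of [y] itself. *)
Lemma recurrent_no_error i : ca head_rule y i <> None.
Proof.
move=> yi; have [_ [[k lek ->] /(_ 0%R (leqnn _)) y0k]] := rec_y (`|i|.+1)%N 0.
apply: y0; rewrite y0k; case: k lek {y0k} => // k lek; rewrite iterSr.
by apply: (error_spreads yi); lia.
Qed.

Lemma recurrent_coherent i : exists x' y', [/\ y i = Some x', y (i + 1)%R = Some y' &
  coherent x' y'].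
Proof.
have := @recurrent_no_error i; rewrite /ca /head_rule.
case: (y (i - 1)%R) => // u; case: (y i) => // v; case: (y (i + 1)%R) => // w.
by case: andP => // -[_ c] _; exists v, w.
Qed.

(** Coherence propagates from the origin: the flag forces the blank on the left, the head forces
    [inr false] on the right. *)
Lemma recurrent_enc q a : y 0%R = Some (Some (true, a, inl q)) ->
  exists T, [/\ y = enc q 0 T, T 0 = a & forall n, compat (T n) (T n.+1)].
Proof.
move=> Ey0.
have pos n : exists a h, y (Posz n) = Some (Some (n == 0, a, h)) /\
    (if n == 0 then h = inl q else h = inr false).
  elim: n => [|n [b [h [yn hn]]]]; first by exists a, (inl q).
  have [x' [y' []]] := recurrent_coherent (Posz n); rewrite yn => -[<-].
  rewrite (_ : (Posz n + 1)%R = Posz n.+1); last by lia.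
  case: y' => // -[[o' a'] h'] /= -> /and3P[no' _ hh]; exists a', h'; split.
    by rewrite (negPf no').
  by move: hh; case: (n) hn => [|m] /= -> /eqP.
have neg n : y (Negz n) = Some None.
  elim: n => [|n IH].
    have [x' [y' []]] := recurrent_coherent (Negz 0).
    rewrite (_ : (Negz 0 + 1)%R = 0%R) // Ey0 => -> -[<-].
    by case: x' => [[[]]|].
  have [x' [y' []]] := recurrent_coherent (Negz n.+1).
  rewrite (_ : (Negz n.+1 + 1)%R = Negz n); last by lia.
  by rewrite IH => -> -[<-]; case: x' => [[[]]|].
pose T n := if y (Posz n) is Some (Some (_, b, _)) then b else a.
exists T; split.
- apply/funext => -[n|n]; last exact: neg.
  have [b [h [yn hn]]] := pos n; rewrite /enc /T yn ltn0.
  by case: (n == 0) hn => ->.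
- by rewrite /T Ey0.
- move=> n; have [x' [y' []]] := recurrent_coherent (Posz n); rewrite /T => ->.
  rewrite (_ : (Posz n + 1)%R = Posz n.+1); last by lia.
  have [b [h [yn _]]] := pos n.+1; rewrite yn => -[<-].
  by case: x' => [[[o c] h']|//] /and3P[].
Qed.
End Recurrent.
End HeadAutomaton.

(** * The register machine *)

(* [IBr r t u] jumps to [t] if register [r] is zero and to [u] otherwise.       *)
Inductive instr : Type :=
| IInc of nat | IDec of nat | IOrc of nat | IBr of nat & nat & nat | IOdo.

Definition ireg (i : instr) : nat :=
  match i with IInc r | IDec r | IOrc r | IBr r _ _ => r | IOdo => 0 end.

(** [a] is the absolute address of the code; a branch with equal targets serves as an unconditional
    jump. *)
Fixpoint flat (c : cmd) (a : nat) : seq instr :=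
  match c with
  | Skip => [::]
  | Inc r => [:: IInc r]
  | Dec r => [:: IDec r]
  | Orc r => [:: IOrc r]
  | Seq c d => let fc := flat c a in fc ++ flat d (a + size fc)
  | While r c =>
      let fc := flat c a.+1 in let e := a.+2 + size fc in
      IBr r e a.+1 :: rcons fc (IBr r a a)
  end.

Fixpoint cmax (c : cmd) : nat :=
  match c with
  | Skip => 0
  | Inc r | Dec r | Orc r => r
  | Seq c d => maxn (cmax c) (cmax d)
  | While r c => maxn r (cmax c)
  end.

Section Machine.
Variables (prog : seq instr) (N K : nat).
Definition instr_at pc := nth IOdo prog pc.

(** Nested options inherit the finite type structure. [Clear] deletes the last unary digit;
    [BackClear b] wipes the register on the way home and writes the value [b] at the origin. *)
Definition mode : finType := option (option (option bool)).
Definition Search : mode := None.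
Definition Back : mode := Some None.
Definition Clear : mode := Some (Some None).
Definition BackClear b : mode := Some (Some (Some b)).

Definition state : finType := ('I_N.+1 * mode)%type.
Definition bits : finType := {ffun 'I_K.+1 -> bool}.
(* Tape letters: oracle bit, odometer bit, and for each register the bit        *)
(* telling whether its value exceeds the position.                              *)
Definition tletter : finType := (bool * bool * bits)%type.

Definition setbit (c : bits) r b : bits := [ffun i => if val i == r then b else c i].
Definition getbit (c : bits) r := c (inord r).

(** [Search] stops at the first unset bit, which [IInc] sets; the last set bit is one cell further
    left, hence the extra mode for [IDec]. [IOdo] marks register 0 along the carry, so this register
    ends up holding the stopping position. *)
Definition delta (q : state) (o : bool) (a : tletter) : state * tletter * option bool :=
  let: (pc, m) := q in let: (d, od, c) := a in
  match m with
  | None =>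
      match instr_at pc with
      | IOdo => if od then (q, (d, false, setbit c 0 true), Some true)
                else ((inord pc.+1, Back), (d, true, c), None)
      | IInc r => if getbit c r then (q, a, Some true)
                  else ((inord pc.+1, Back), (d, od, setbit c r true), None)
      | IDec r => if getbit c r then (q, a, Some true)
                  else if o then ((inord pc.+1, Search), a, None)
                  else ((pc, Clear), a, Some false)
      | IOrc r => if getbit c r then (q, a, Some true) else ((pc, BackClear d), a, None)
      | IBr r t u => ((inord (if getbit c r then u else t), Search), a, None)
      end
  | Some None => if o then ((pc, Search), a, None) else (q, a, Some false)
  | Some (Some None) =>
      ((inord pc.+1, Back), (d, od, setbit c (ireg (instr_at pc)) false), None)
  | Some (Some (Some b)) =>
      if o then ((inord pc.+1, Search), (d, od, setbit c (ireg (instr_at pc)) b), None)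
      else (q, (d, od, setbit c (ireg (instr_at pc)) false), Some false)
  end.

Definition monotone : rel tletter := fun a a' => [forall i, a'.2 i ==> a.2 i].

Definition machine_rule := head_rule delta monotone.
Notation f := (ca machine_rule).
Notation conf := (config (letters state tletter)).

(** * Machine steps as steps of the automaton *)

Section Runs.
Variable D : nat -> bool.
Implicit Types (s : regs) (od : nat -> bool) (p pc r : nat) (x y z : conf).

Definition tape (od : nat -> bool) (s : regs) (n : nat) : tletter :=
  (D n, od n, [ffun i : 'I_K.+1 => n < s i]).

Definition config_of (pc : nat) (m : mode) (p : nat) (od : nat -> bool) (s : regs) : conf :=
  enc ((inord pc, m) : state) p (tape od s).

Lemma step_config pc m p od s q' m' a' d p' od' s' : pc <= N ->
  delta (inord pc, m) (p == 0) (tape od s p) = ((inord q', m'), a', d) ->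
  (p = 0 -> d <> Some false) -> p' = move d p -> a' = tape od' s' p ->
  (forall n, n != p -> od' n = od n) ->
  (forall n (i : 'I_K.+1), n != p -> (n < s' i) = (n < s i)) ->
  f (config_of pc m p od s) = config_of q' m' p' od' s'.
Proof.
move=> pcN Ed d0 -> Ea Hod Hs; rewrite /config_of (ca_enc _ Ed) //; last first.
  move=> n; apply/forallP => i; rewrite !ffunE; apply/implyP; exact: ltnW.
congr enc; apply/funext => n; case: eqP => [->|/eqP np]; first exact: Ea.
by rewrite /tape Hod //; congr (_, _); apply/ffunP => i; rewrite !ffunE Hs.
Qed.

Lemma getbit_tape s p r : r <= K -> getbit [ffun i : 'I_K.+1 => p < s i] r = (p < s r).
Proof. by move=> rK; rewrite /getbit ffunE inordK. Qed.

Lemma setbit_tape s p r b v : (p < v) = b ->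
  setbit [ffun i : 'I_K.+1 => p < s i] r b = [ffun i : 'I_K.+1 => p < upd s r v i].
Proof. by move=> pv; apply/ffunP => i; rewrite !ffunE /upd /=; case: eqP. Qed.

Lemma upd_ltn s r v p : p <= s r <= p.+1 -> p <= v <= p.+1 ->
  forall n (i : 'I_K.+1), n != p -> (n < upd s r v i) = (n < s i).
Proof. by move=> Hs Hv n i np; rewrite /upd; case: eqP => // ->; lia. Qed.

Definition at_start (x : conf) : bool :=
  if x 0%R is Some (Some (_, _, inl q)) then q == (inord 0, Search) else false.

Lemma at_startE pc m p od s : at_start (config_of pc m p od s) =
  [&& p == 0, (inord pc : 'I_N.+1) == inord 0 & m == Search].
Proof. by rewrite /at_start /config_of /enc; case: p. Qed.

Lemma not_at_start pc m p od s : 0 < pc -> pc <= N -> ~~ at_start (config_of pc m p od s).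
Proof.
move=> pc0 pcN; rewrite at_startE; apply/negP => /and3P[_ /eqP/(congr1 val)].
by rewrite /= !inordK //; lia.
Qed.

(** Recording that the start is avoided on the way places every later visit of the start after [y];
    [run_cut] exploits this. *)
Definition run k (x y : conf) :=
  iter k f x = y /\ forall j, 0 < j <= k -> ~~ at_start (iter j f x).

Lemma run0 x : run 0 x x. Proof. by split=> // j; lia. Qed.

Lemma run1 x y : f x = y -> ~~ at_start y -> run 1 x y.
Proof. by move=> <- h; split=> // j j1; rewrite (_ : j = 1) //; lia. Qed.

Lemma run_trans k l x y z : run k x y -> run l y z -> run (k + l) x z.
Proof.
move=> [<- Hk] [<- Hl]; split; first by rewrite addnC iterD.
move=> j jkl; case: (leqP j k) => jk; first by apply: Hk; lia.
by rewrite -(subnK (ltnW jk)) iterD; apply: Hl; lia.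
Qed.

Lemma run_cut k l x y : run k x y -> 0 < l -> at_start (iter l f x) ->
  k < l /\ iter (l - k) f y = iter l f x.
Proof.
move=> [<- H] l0 hl; have kl : k < l.
  by rewrite ltnNge; apply: contraL hl => lk; apply: H; rewrite l0.
by split=> //; rewrite -iterD subnK // ltnW.
Qed.

Definition scans i r := i = IInc r \/ i = IDec r \/ i = IOrc r.

Lemma run_search pc r od s p : 0 < pc <= N -> r <= K -> scans (instr_at pc) r -> p <= s r ->
  run p (config_of pc Search 0 od s) (config_of pc Search p od s).
Proof.
move=> /andP[pc0 pcN] rK sc; elim: p => [|p IH] ps; first exact: run0.
rewrite -addn1; apply: run_trans (IH (ltnW ps)) _; apply: run1; last exact: not_at_start.
apply: (@step_config _ _ _ _ _ pc _ (tape od s p) (Some true)); rewrite ?addn1 //.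
by rewrite /= inordK //; case: sc => [|[]] ->; rewrite getbit_tape // ps.
Qed.

Lemma run_back pc od s p : 0 < pc <= N ->
  run p.+1 (config_of pc Back p od s) (config_of pc Search 0 od s).
Proof.
move=> /andP[pc0 pcN]; elim: p => [|p IH].
  apply: run1; last exact: not_at_start.
  exact: (@step_config _ _ _ _ _ pc _ (tape od s 0) None).
rewrite -addn1 addnC; apply: run_trans IH; apply: run1; last exact: not_at_start.
exact: (@step_config _ _ _ _ _ pc _ (tape od s p.+1) (Some false)).
Qed.

(** The register has value p at the turning point and p + 1 afterwards, the bits beyond being wiped
    already. *)
Lemma run_backclear pc r b od s p : 0 < pc < N -> instr_at pc = IOrc r ->
  p <= s r <= p.+1 ->
  run p.+1 (config_of pc (BackClear b) p od s) (config_of pc.+1 Search 0 od (upd s r b)).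
Proof.
move=> /andP[pc0 pcN] I; elim: p s => [|p IH] s sr.
  apply: run1; last exact: not_at_start.
  apply: (@step_config _ _ _ _ _ pc.+1 _ (tape od (upd s r b) 0) None) => //.
  - exact: ltnW.
  - rewrite /= inordK; last exact: ltnW.
    by rewrite I (@setbit_tape _ _ _ _ (nat_of_bool b)) //; case: b.
  - by apply: upd_ltn => //; case: b.
rewrite -addn1 addnC; rewrite -(upd_upd s r p.+1 b); apply: run_trans (IH _ _).
  apply: run1; last by apply: not_at_start => //; apply: ltnW.
  apply: (@step_config _ _ _ _ _ pc _ (tape od (upd s r p.+1) p.+1) (Some false)) => //.
  - exact: ltnW.
  - rewrite /= inordK; last exact: ltnW.
    by rewrite I (@setbit_tape _ _ _ _ p.+1) // ltnn.
  - by apply: upd_ltn => //; lia.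
by rewrite /upd eqxx; lia.
Qed.

Definition reach x y := exists k, run k x y.
Definition reach_plus x y := exists2 k, 0 < k & run k x y.
Lemma reach_plusW x y : reach_plus x y -> reach x y. Proof. by case=> k _; exists k. Qed.
Lemma reach_refl x : reach x x. Proof. exists 0; exact: run0. Qed.
Lemma reach_trans x y z : reach x y -> reach y z -> reach x z.
Proof. by move=> [k Hk] [l Hl]; exists (k + l); apply: run_trans Hk Hl. Qed.

Notation S pc od s := (config_of pc Search 0 od s).

Lemma reach_inc pc r od s : 0 < pc < N -> r <= K -> instr_at pc = IInc r ->
  reach (S pc od s) (S pc.+1 od (upd s r (s r).+1)).
Proof.
move=> /andP[pc0 pcN] rK I.
have pcN' : 0 < pc <= N by rewrite pc0 ltnW.
exists (s r + (1 + (s r).+1)); apply: run_trans (run_search _ pcN' rK _ (leqnn _)) _.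
  by left.
apply: run_trans (run_back _ _ _ _) => //; apply: run1; last exact: not_at_start.
apply: (@step_config _ _ _ _ _ pc.+1 _ (tape od (upd s r (s r).+1) (s r)) None) => //.
- exact: ltnW.
- rewrite /= inordK; last exact: ltnW.
  by rewrite I getbit_tape // ltnn (@setbit_tape _ _ _ _ (s r).+1) // ltnSn.
- by apply: upd_ltn; lia.
Qed.

Lemma reach_dec pc r od s : 0 < pc < N -> r <= K -> instr_at pc = IDec r ->
  reach (S pc od s) (S pc.+1 od (upd s r (s r).-1)).
Proof.
move=> /andP[pc0 pcN] rK I.
have pcN' : 0 < pc <= N by rewrite pc0 ltnW.
have [s0|s0] := posnP (s r).
  have -> : upd s r (s r).-1 = s by rewrite -[RHS](upd_id s r) s0.
  exists 1; apply: run1; last exact: not_at_start.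
  apply: (@step_config _ _ _ _ _ pc.+1 _ (tape od s 0) None) => //.
    exact: ltnW.
  rewrite /= inordK; last exact: ltnW.
  by rewrite I getbit_tape // s0.
exists (s r + (1 + (1 + (s r).-1.+1))).
apply: run_trans (run_search _ pcN' rK _ (leqnn _)) _; first by right; left.
apply: run_trans.
  apply: run1; last by apply: (@not_at_start pc Clear (s r).-1 od s) => //; apply: ltnW.
  apply: (@step_config _ _ _ _ _ pc _ (tape od s (s r)) (Some false)) => //.
  - exact: ltnW.
  - rewrite /= inordK; last exact: ltnW.
    by rewrite I getbit_tape // ltnn ifN // -lt0n.
  - by move=> E0; rewrite E0 in s0.
apply: run_trans (run_back _ _ _ _) => //; apply: run1; last exact: not_at_start.
apply: (@step_config _ _ _ _ _ pc.+1 _ (tape od (upd s r (s r).-1) (s r).-1) None) => //.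
- exact: ltnW.
- rewrite /= inordK; last exact: ltnW.
  by rewrite I (@setbit_tape _ _ _ _ (s r).-1) // ltnn.
- by apply: upd_ltn; lia.
Qed.

Lemma reach_orc pc r od s : 0 < pc < N -> r <= K -> instr_at pc = IOrc r ->
  reach (S pc od s) (S pc.+1 od (upd s r (D (s r)))).
Proof.
move=> /andP[pc0 pcN] rK I.
have pcN' : 0 < pc <= N by rewrite pc0 ltnW.
exists (s r + (1 + (s r).+1)); apply: run_trans (run_search _ pcN' rK _ (leqnn _)) _.
  by right; right.
apply: run_trans (run_backclear _ _ _ I _); rewrite ?pc0 //; last by lia.
apply: run1; last by apply: not_at_start => //; apply: ltnW.
apply: (@step_config _ _ _ _ _ pc _ (tape od s (s r)) None) => //.
  exact: ltnW.
rewrite /= inordK; last exact: ltnW.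
by rewrite I getbit_tape // ltnn.
Qed.

Lemma step_br pc r t u od s : pc <= N -> r <= K -> instr_at pc = IBr r t u ->
  f (S pc od s) = S (if s r == 0 then t else u) od s.
Proof.
move=> pcN rK I.
apply: (@step_config _ _ _ _ _ (if s r == 0 then t else u) _ (tape od s 0) None) => //.
rewrite /= inordK // I getbit_tape //; by case: (s r).
Qed.

Lemma reach_br pc r t u od s : 0 < pc <= N -> r <= K -> instr_at pc = IBr r t u ->
  0 < t <= N -> 0 < u <= N ->
  reach_plus (S pc od s) (S (if s r == 0 then t else u) od s).
Proof.
move=> /andP[pc0 pcN] rK I tN uN; exists 1 => //; apply: run1; first exact: step_br I.
by apply: not_at_start; case: ifP; lia.
Qed.

(** * Execution of compiled code on the tape *)

Definition code_at a (code : seq instr) :=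
  forall i, i < size code -> instr_at (a + i) = nth IOdo code i.

Lemma code_at_cat a c d : code_at a (c ++ d) -> code_at a c /\ code_at (a + size c) d.
Proof.
move=> H; split=> i lti.
  by rewrite H ?nth_cat ?lti // size_cat; lia.
by rewrite -addnA H ?size_cat ?ltn_add2l // nth_cat ifN ?addKn //; lia.
Qed.

Lemma code_at_while a r c : code_at a (flat (While r c) a) ->
  let e := a.+2 + size (flat c a.+1) in
  [/\ instr_at a = IBr r e a.+1, code_at a.+1 (flat c a.+1) & instr_at e.-1 = IBr r a a].
Proof.
move=> H e; split; first by have := H 0 isT; rewrite addn0.
  have /= H' : code_at a (_ :: _) := H.
  rewrite -cats1 -cat1s in H'; have [_ /code_at_cat[]] := code_at_cat H'.
  by rewrite addn1.
have {H} := H (size (flat c a.+1)).+1; rewrite /= size_rcons ltnSn => /(_ isT).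
by rewrite nth_rcons ltnn eqxx => <-; congr instr_at; rewrite /e; lia.
Qed.

Lemma reach_flat c a od s s' : exec D c s s' -> 0 < a -> a + size (flat c a) <= N ->
  cmax c <= K -> code_at a (flat c a) ->
  reach (S a od s) (S (a + size (flat c a)) od s').
Proof.
move=> ex; elim: ex a => {c s s'}.
- by move=> s a *; rewrite addn0; apply: reach_refl.
- move=> r s a a0 aN rK H; rewrite addn1; apply: reach_inc => //; first by move: aN => /=; lia.
  by have := H 0 isT; rewrite addn0.
- move=> r s a a0 aN rK H; rewrite addn1; apply: reach_dec => //; first by move: aN => /=; lia.
  by have := H 0 isT; rewrite addn0.
- move=> r s a a0 aN rK H; rewrite addn1; apply: reach_orc => //; first by move: aN => /=; lia.
  by have := H 0 isT; rewrite addn0.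
- move=> c d s1 s2 s3 _ IHc _ IHd a a0 /=; rewrite size_cat addnA => aN.
  rewrite geq_max => /andP[cK dK] /code_at_cat[Hc Hd].
  apply: reach_trans (IHc _ a0 _ cK Hc) _; first by lia.
  by apply: IHd => //; lia.
- move=> r c s r0 a a0 /= aN; rewrite geq_max => /andP[rK cK] /code_at_while[I _ _].
  have := @reach_br _ _ _ _ od s _ rK I; rewrite r0 /= => H.
  rewrite size_rcons in aN *; rewrite (_ : a + _ = a.+2 + size (flat c a.+1)); last by lia.
  by apply/reach_plusW/H; lia.
- move=> r c s1 s2 s3 r0 _ IHc _ IHw a a0 aN cK Hw.
  have [I Hc I'] := code_at_while Hw.
  have aN' : a.+2 + size (flat c a.+1) <= N by move: aN; rewrite /= size_rcons; lia.
  have [rK cK'] : r <= K /\ cmax c <= K by move: cK; rewrite /= geq_max => /andP.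
  apply: reach_trans (_ : reach _ (S a.+1 od s1)) _.
    have := @reach_br _ _ _ _ od s1 _ rK I; rewrite ifN; last exact/eqP.
    by move=> H; apply/reach_plusW/H; lia.
  apply: reach_trans (IHc _ _ _ cK' Hc) _ => //; first by lia.
  apply: reach_trans (IHw a a0 aN cK Hw).
  have := @reach_br _ _ _ _ od s2 _ rK I'; rewrite if_same => H.
  by apply/reach_plusW/H; lia.
Qed.
End Runs.
End Machine.

(** * The odometer and the verification program *)

Section Odometer.
Implicit Types (od : nat -> bool) (m n p : nat) (ps : seq nat).

Definition stops od p := od p = false /\ forall n, n < p -> od n.
Definition odo_next od p n := if n < p then false else if n == p then true else od n.

Fixpoint odo_path od ps : Prop :=
  if ps is p :: ps' then stops od p /\ odo_path (odo_next od p) ps' else True.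
Definition odo_run od ps := foldl odo_next od ps.

Lemma odo_next_gt od p m : p < m -> odo_next od p m = od m.
Proof. by move=> pm; rewrite /odo_next ltnNge ltnW //= gtn_eqF. Qed.

(** Only a carry stopping at m sets bit m; carries passing over it clear it. *)
Lemma odo_run_le od ps m : odo_path od ps -> m \notin ps -> odo_run od ps m -> od m.
Proof.
elim: ps od => [|p ps IH] od //= [[p0 p1] Hps]; rewrite inE negb_or => /andP[mp mps].
move=> /(IH _ Hps mps); rewrite /odo_next (negPf mp); case: ltnP => // _; exact.
Qed.

(** A carry beyond m passes over a set bit m and clears it, and without a stop at m nothing sets it
    again. *)
Lemma odo_run_fixed_bit od ps m : odo_path od ps -> m \notin ps ->
  odo_run od ps m = od m -> all (ltn^~ m) ps.
Proof.
elim: ps od => [|p ps IH] od //= [[p0 p1] Hps]; rewrite inE negb_or => /andP[mp mps] E.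
case: (ltngtP p m) mp => // [lt|gt] _; first by apply: (IH _ Hps mps); rewrite odo_next_gt.
have := odo_run_le Hps mps; rewrite -/(odo_run _ _) E p1 // => /(_ isT).
by rewrite /odo_next gt.
Qed.

Lemma odo_run_set_bit od ps m : odo_path od ps -> all (leq^~ m) ps -> od m ->
  odo_run od ps m /\ m \notin ps.
Proof.
elim: ps od => [|p ps IH] od //= [[p0 p1] Hps] /andP[pm psm] odm.
have lt : p < m by rewrite ltn_neqAle pm andbT; apply: contraTneq odm => <-; rewrite p0.
have [|r nin] := IH _ Hps psm; first by rewrite odo_next_gt.
by rewrite inE negb_or nin andbT; split=> //; rewrite gtn_eqF.
Qed.

Lemma odo_run_flip od ps m : odo_path od ps -> all (leq^~ m) ps -> m \in ps ->
  od m = false /\ odo_run od ps m.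
Proof.
elim: ps od => [|p ps IH] od //= [[p0 p1] Hps] /andP[pm psm]; rewrite inE.
have [mp _|mp] := eqVneq m p.
  subst m; split=> //; have [|//] := odo_run_set_bit Hps psm.
  by rewrite /odo_next ltnn eqxx.
move=> /= mps; have lt : p < m by rewrite ltn_neqAle eq_sym mp.
by have := IH _ Hps psm mps; rewrite odo_next_gt.
Qed.

(** Descent on m: a carry at the highest allowed place flips that bit for good, since clearing it
    takes a longer carry. So the bound drops until no place is left. *)
Lemma odo_run_return od ps m : odo_path od ps -> all (ltn^~ m) ps ->
  (forall n, n < m -> odo_run od ps n = od n) -> ps = [::].
Proof.
elim: m => [|m IH] Hps psm E; first by case: ps psm {Hps E}.
have [mps|mps] := boolP (m \in ps).
  by have := E m (ltnSn m); have [-> ->] := odo_run_flip Hps psm mps.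
apply: IH => // [|n ltn]; last by apply: E; apply: ltnW.
by apply: odo_run_fixed_bit Hps mps _; apply: E.
Qed.

Lemma odo_return_stops od ps m : odo_path od ps -> ps <> [::] ->
  (forall n, n <= m -> odo_run od ps n = od n) -> m \in ps.
Proof.
move=> Hps ps0 E; apply/negPn/negP => mps; apply: ps0.
apply: (odo_run_return Hps (odo_run_fixed_bit Hps mps (E m (leqnn m)))) => n ltn.
by apply: E; apply: ltnW.
Qed.
End Odometer.

(** * The verification program and its rounds *)

Section Program.
Variable T : prf.

(** Register 0 holds m, 1 the candidate l, 2 the truth value, and 3 is the flag that keeps the
    search going; scratch starts at 4. *)
Definition try_witness := Seq (compile T [:: 0; 1] 2 4)
  (Seq (Inc 1) (While 2 (Seq (Dec 2) (Dec 3)))).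
Definition maxreg := maxn 3 (cmax try_witness).
Definition clear_all := foldr (fun r c => Seq (clear r) c) Skip (iota 0 maxreg.+1).
Definition main := Seq (Inc 3) (Seq (While 3 try_witness) clear_all).
Definition program := IOdo :: rcons (flat main 1) (IBr 0 0 0).
Definition last_pc := (size (flat main 1)).+1.

Notation f := (ca (@machine_rule program last_pc maxreg)).
Notation at_pc := (instr_at program).

Lemma cmax_clear_all : cmax clear_all <= maxreg.
Proof.
rewrite /clear_all; have : all (leq^~ maxreg) (iota 0 maxreg.+1).
  by apply/allP => i; rewrite mem_iota.
by elim: (iota _ _) => //= r rs IH /andP[rK /IH]; rewrite !geq_max rK.
Qed.

Lemma cmax_main : cmax main <= maxreg.
Proof.
have -> : cmax main = maxn 3 (maxn maxreg (cmax clear_all)) by [].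
have H a b c : a <= c -> b <= c -> maxn a b <= c by rewrite geq_max => -> ->.
by apply: (H); last apply: (H); [apply: leq_maxl | exact: leqnn | exact: cmax_clear_all].
Qed.

Lemma code_main : code_at program 1 (flat main 1).
Proof.
move=> i lti; rewrite -[LHS]/(nth IOdo (rcons (flat main 1) (IBr 0 0 0)) i).
by rewrite nth_rcons lti.
Qed.

Lemma last_instr : at_pc last_pc = IBr 0 0 0.
Proof.
rewrite -[LHS]/(nth IOdo (rcons (flat main 1) (IBr 0 0 0)) (size (flat main 1))).
by rewrite nth_rcons ltnn eqxx.
Qed.

Section Oracle.
Variables (D : nat -> bool) (r : nat -> nat -> bool).
Hypothesis T_computes : forall m l, evalp D T [:: m; l] (r m l).

Implicit Types (od : nat -> bool) (s : regs) (ps : seq nat).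

Definition zero : regs := fun _ => 0.
Notation S pc od s := (@config_of last_pc maxreg D pc Search 0 od s).
Notation hit := (@at_start last_pc maxreg).
Notation run := (@run program last_pc maxreg).
Notation reach := (@reach program last_pc maxreg).
Notation reach_plus := (@reach_plus program last_pc maxreg).

Lemma exec_try m l s : s 0 = m -> s 1 = l -> s 3 = 1 ->
  exists s', [/\ exec D try_witness s s', s' 0 = m, s' 1 = l.+1 &
    s' 3 = ~~ r m l].
Proof.
move=> s0 s1 s3.
have [//|//|//||s' [E v H]] := @exec_compile D T [:: 0; 1] 2 4 s (r m l).
  by rewrite /= s0 s1.
pose s2 := upd s' 1 (s' 1).+1.
have Es2 : exec D (Seq (compile T [:: 0; 1] 2 4) (Inc 1)) s s2.
  by apply: ex_seq E (ex_inc _ _ _).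
case rml : (r m l) v => v; last first.
  exists s2; split.
  - apply: ex_seq E _; apply: ex_seq (ex_inc _ _ _) _.
    by apply: ex_while0; rewrite /upd.
  - by rewrite /s2 /upd /= H.
  - by rewrite /s2 /upd /= H ?s1.
  - by rewrite /s2 /upd /= H.
exists (upd (upd s2 2 0) 3 0); split.
- apply: ex_seq E _; apply: ex_seq (ex_inc _ _ _) _.
  apply: (@ex_whileS _ _ _ _ (upd (upd s2 2 0) 3 0)).
  + by rewrite /upd /= v.
  + have -> : upd (upd s2 2 0) 3 0 = upd (upd s2 2 (s2 2).-1) 3 (upd s2 2 (s2 2).-1 3).-1.
      have -> : upd s2 2 (s2 2).-1 3 = 1 by rewrite /s2 /upd /= H.
      by have -> : s2 2 = 1 by rewrite /s2 /upd /= v.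
    exact: ex_seq (ex_dec _ _ _) (ex_dec _ _ _).
  + by apply: ex_while0; rewrite /upd.
- by rewrite /s2 /upd /= H.
- by rewrite /s2 /upd /= H ?s1.
- by rewrite /upd.
Qed.

Lemma exec_search m l d s : r m (l + d) -> s 0 = m -> s 1 = l -> s 3 = 1 ->
  exists s', exec D (While 3 try_witness) s s'.
Proof.
elim: d l s => [|d IH] l s rml s0 s1 s3;
  have [s' [E' s0' s1' s3']] := exec_try s0 s1 s3.
  exists s'; apply: ex_whileS E' _; first by rewrite s3.
  by apply: ex_while0; rewrite s3' -[l]addn0 rml.
have [rl|rl] := boolP (r m l).
  exists s'; apply: ex_whileS E' _; first by rewrite s3.
  by apply: ex_while0; rewrite s3' rl.
have [||||s2 E2] := IH l.+1 s'; rewrite ?s3' ?rl ?addSnnS //.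
by exists s2; apply: ex_whileS E' E2; rewrite s3.
Qed.

Lemma exec_clear_all s : exists s', exec D clear_all s s' /\
  forall i, i <= maxreg -> s' i = 0.
Proof.
have [s' [E H]] : exists s', exec D clear_all s s' /\
    forall i, s' i = if i \in iota 0 maxreg.+1 then 0 else s i.
  rewrite /clear_all; elim: (iota _ _) s => [|k rs IH] s.
    by exists s; split=> //; apply: ex_skip.
  have [s' [E H]] := IH (upd s k 0); exists s'; split.
    by apply: ex_seq E; apply: exec_clear.
  by move=> i; rewrite H inE /upd; case: eqP => //=; rewrite if_same.
by exists s'; split=> // i iK; rewrite H mem_iota /= ltnS iK.
Qed.

Lemma exec_main m : (exists l, r m l) ->
  exists s', exec D main (upd zero 0 m) s' /\ forall i, i <= maxreg -> s' i = 0.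
Proof.
move=> [l rl].
have [//|//|//|//|s1 E1] := @exec_search m 0 l (upd (upd zero 0 m) 3 1).
have [s2 [E2 H]] := exec_clear_all s1; exists s2; split=> //.
by apply: ex_seq (ex_inc _ _ _) _; apply: ex_seq E1 E2.
Qed.

Lemma run_odometer od p : (forall n, n < p -> od n) ->
  run p (S 0 od zero)
    (@config_of last_pc maxreg D 0 Search p (fun n => (p <= n) && od n) (upd zero 0 p)).
Proof.
elim: p => [|p IH] odp.
  by rewrite (_ : upd zero 0 0 = zero) ?upd_id //; apply: run0.
rewrite -addn1; apply: run_trans (IH _) _; first by move=> n /ltnW; apply: odp.
apply: run1; last by rewrite at_startE addn1.
apply: (@step_config _ _ _ _ _ _ _ _ _ 0 _
   (tape maxreg D (fun n => (p.+1 <= n) && od n) (upd zero 0 p.+1) p) (Some true));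
  rewrite ?addn1 //.
- rewrite /= inordK //= leqnn odp // /tape ltnn.
  by rewrite (@setbit_tape _ _ _ _ _ p.+1) ?upd_upd // ltnSn.
- by move=> n np; rewrite ltn_neqAle eq_sym np.
- by move=> n i np; rewrite /upd; case: eqP => // _; lia.
Qed.

Lemma reach_carry od p : stops od p ->
  reach (S 0 od zero) (S 1 (odo_next od p) (upd zero 0 p)).
Proof.
move=> [p0 p1]; exists (p + (1 + p.+1)); apply: run_trans (run_odometer p1) _.
apply: run_trans; last exact: run_back.
apply: run1; last exact: not_at_start.
apply: (@step_config _ _ _ _ _ _ _ _ _ 1 _
  (tape maxreg D (odo_next od p) (upd zero 0 p) p) None) => //.
  by rewrite /= inordK //= leqnn p0 /tape /odo_next ltnn eqxx.
by move=> n np; rewrite /odo_next (negPf np); case: ltngtP np.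
Qed.

Lemma config_of_ext pc m p od s s' : (forall i, i <= maxreg -> s i = s' i) ->
  @config_of last_pc maxreg D pc m p od s = @config_of last_pc maxreg D pc m p od s'.
Proof.
move=> H; rewrite /config_of; congr enc; apply/funext => n; rewrite /tape; congr (_, _).
by apply/ffunP => i; rewrite !ffunE H // -ltnS.
Qed.

(** The final jump is split off because a [run] may not enter the start. *)
Lemma round od p : stops od p -> (exists l, r p l) ->
  exists k y, [/\ run k (S 0 od zero) y & f y = S 0 (odo_next od p) zero].
Proof.
move=> Hp Hr; have [s' [Es' H]] := exec_main Hr.
have := reach_flat (odo_next od p) Es' _ _ cmax_main code_main.
move=> /(_ last_pc isT (leqnn _)) /(reach_trans (reach_carry Hp))[k Hk].
exists k, (S last_pc (odo_next od p) s'); split=> //.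
rewrite (@step_br _ _ _ _ _ 0 0 0) ?last_instr // if_same.
exact: config_of_ext.
Qed.

Lemma round_iter od p : stops od p -> (exists l, r p l) ->
  exists2 k, 0 < k & iter k f (S 0 od zero) = S 0 (odo_next od p) zero.
Proof.
move=> Hp Hr; have [k [y [[Ey _] <-]]] := round Hp Hr.
by exists k.+1; rewrite // iterS Ey.
Qed.

(** Strong induction on time: a failed trial leads back to the loop test in a positive number of
    steps that avoid the start. The candidate and the scratch registers change, so [s] is
    constrained only at 0 and 3. *)
Lemma diverge od s m : s 0 = m -> s 3 = 1 -> (forall l, ~~ r m l) ->
  forall k, 0 < k -> ~~ hit (iter k f (S 2 od s)).
Proof.
move=> s0 s3 nr k; elim/ltn_ind: k s s0 s3 => k IH s s0 s3 k0.
apply/negP => hk.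
set w := flat (While 3 try_witness) 2.
have H1 : code_at program 1 ([:: IInc 3] ++ (w ++ flat clear_all (2 + size w))).
  exact: code_main.
have [_ H2] := code_at_cat H1; have [Hw _] := code_at_cat H2.
have {H1 H2}Hw : code_at program 2 w by [].
have [I Hc I'] := code_at_while Hw.
have sz : 4 + size (flat try_witness 3) <= last_pc.
  have size_w : size w = 2 + size (flat try_witness 3).
    pose br := IBr 3 (4 + size (flat try_witness 3)) 3.
    rewrite -[w]/(br :: rcons (flat try_witness 3) (IBr 3 2 2)) [LHS]/=.
    by rewrite size_rcons.
  rewrite /last_pc -[flat main 1]/([:: IInc 3] ++ (w ++ flat clear_all (2 + size w))).
  rewrite (size_cat [:: IInc 3]) (size_cat w) size_w.
  have le X Y : 4 + X <= (1 + (2 + X + Y)).+1 by lia.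
  exact: le.
have [s' [E' s0' _ s3']] := exec_try s0 (erefl (s 1)) s3.
have K3 : 3 <= maxreg by apply: leq_maxl.
have [j j0 Hj] : reach_plus (S 2 od s) (S 3 od s).
  have := @reach_br _ _ _ D _ _ _ _ od s _ K3 I; rewrite s3 => H.
  by apply: H; lia.
have [j' Hj'] : reach (S 3 od s) (S 2 od s').
  apply: reach_trans (reach_flat od E' _ _ (leq_maxr _ _) Hc) _ => //; first by lia.
  have := @reach_br _ _ _ D _ _ _ _ od s' _ K3 I'; rewrite if_same => H.
  by apply/reach_plusW/H; lia.
have [lt Ek] := run_cut (run_trans Hj Hj') k0 hk.
suff : ~~ hit (iter (k - (j + j')) f (S 2 od s')) by rewrite Ek hk.
by apply: IH => //; [lia | rewrite s3' nr | lia].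
Qed.

Lemma hit_round od k : 0 < k -> hit (iter k f (S 0 od zero)) ->
  exists p, [/\ stops od p, exists l, r p l &
    exists2 k', k' < k & iter k f (S 0 od zero) = iter k' f (S 0 (odo_next od p) zero)].
Proof.
move=> k0 hk.
(* Were every bit set, the carry would still be running at time [k], away from the start. *)
have [p Hp] : exists p, stops od p.
  have /existsNP[n odn] : ~ forall n, od n.
    move=> odT; have [_ /(_ k)] := run_odometer (p := k) (fun n _ => odT n).
    by rewrite k0 leqnn hk => /(_ isT).
  have ex : exists n, ~~ od n by exists n; apply/negP.
  case: (ex_minnP ex) => p /negPf p0 pmin; exists p; split=> // i ip.
  by apply: contraTT ip => /pmin; rewrite -leqNgt.
exists p; have [Hr|/forallNP nr] := pselect (exists l, r p l).
  split=> //; have [j [y [Hj Ey]]] := round Hp Hr.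
  have [lt <-] := run_cut Hj k0 hk; exists (k - j).-1; first by lia.
  by rewrite -Ey -iterSr prednK // subn_gt0.
have I : at_pc 1 = IInc 3 by [].
have [j Hj] : reach (S 0 od zero)
    (S 2 (odo_next od p) (upd (upd zero 0 p) 3 (upd zero 0 p 3).+1)).
  by apply: reach_trans (reach_carry Hp) _; apply: reach_inc => //; apply: leq_maxl.
have [lt Ek] := run_cut Hj k0 hk.
have kj : 0 < k - j by rewrite subn_gt0.
have := @diverge (odo_next od p) (upd (upd zero 0 p) 3 (upd zero 0 p 3).+1) p
  erefl erefl (fun l => introN idP (nr l)) (k - j) kj.
by rewrite Ek hk.
Qed.

Lemma hit_rounds od k : 0 < k -> hit (iter k f (S 0 od zero)) ->
  exists ps, [/\ odo_path od ps, ps <> [::], forall p, p \in ps -> exists l, r p l &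
    iter k f (S 0 od zero) = S 0 (odo_run od ps) zero].
Proof.
elim/ltn_ind: k od => k IH od k0 hk.
have [p [Hp Hr [k' ltk Ek]]] := hit_round k0 hk.
have [k'0|k'0] := posnP k'.
  exists [:: p]; split=> //; last by rewrite Ek k'0.
  by move=> q; rewrite inE => /eqP->.
rewrite Ek in hk; have [ps [Hps _ Hrs E']] := IH _ ltk _ k'0 hk.
exists (p :: ps); split=> //; last by rewrite Ek E'.
by move=> q; rewrite inE => /predU1P[->|/Hrs].
Qed.

(** Doubling: fill the bits below n, carry once into bit n, which clears them, and fill them again.
    The middle round takes at least one step, whence the bound on the time. *)
Lemma carry_all od n : (forall m, exists l, r m l) -> (forall i, i < n -> od i = false) ->
  exists2 k, n <= k &
    iter k f (S 0 od zero) = S 0 (fun i => (i < n) || od i) zero.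
Proof.
move=> Hr; elim: n od => [|n IH] od od0; first by exists 0.
have [|k1 le1 E1] := IH od; first by move=> i /ltnW; apply: od0.
have st : stops (fun i => (i < n) || od i) n.
  by split=> [|i ->//]; rewrite ltnn od0.
have [k2 k20 E2] := round_iter st (Hr n).
have [|k3 le3 E3] := IH (odo_next (fun i => (i < n) || od i) n).
  by move=> i lti; rewrite /odo_next lti.
exists (k3 + (k2 + k1)); first by lia.
rewrite iterD iterD E1 E2 E3; congr config_of; apply/funext => i.
by rewrite /odo_next ltnS; case: (ltngtP i n).
Qed.

Lemma recurrent_start : (forall m, exists l, r m l) ->
  nonwandering f (S 0 (fun _ => false) zero).
Proof.
(* [M] bounds the return time and lies outside the window, so the one bit left changed by the last
   carry is not seen. *)
move=> Hr n m; set M := maxn n m.+1.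
have [//|k1 le1 E1] := @carry_all (fun _ => false) M Hr.
have st : stops (fun i => (i < M) || false) M by split=> [|i ->//]; rewrite ltnn.
have [k2 k20 E2] := round_iter st (Hr M).
exists (iter (k2 + k1) f (S 0 (fun _ => false) zero)); split.
  by exists (k2 + k1) => //; lia.
move=> i lei; rewrite iterD E1 E2; case: i lei => [i|i] //= lei.
by rewrite /tape /odo_next; have -> : i < M by lia.
Qed.

(** A return in the window m restores the bits 0 to m, so some carry on the way stopped at m, and
    its round found a witness. *)
Lemma recurrent_verified od : nonwandering f (S 0 od zero) -> forall m, exists l, r m l.
Proof.
move=> rec m; have [_ [[k k0 ->] agr]] := rec 1 m.
have hk : hit (iter k f (S 0 od zero)).
  by rewrite /at_start -(agr 0%R) //= eqxx.
have [ps [Hps ps0 Hrs Ek]] := hit_rounds k0 hk; apply: Hrs.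
apply: odo_return_stops Hps ps0 _ => n len.
by have := agr (Posz n) len; rewrite Ek /config_of /enc /tape => -[].
Qed.
End Oracle.
End Program.

(** * The reduction *)

(* For input w and guess C the oracle tape is 1^(w+1) 0 C, so that the word      *)
(* given by the reduction leaves C free.                                        *)
Definition first_zero := PMu POrc.

Fixpoint offset (e : prf) : prf :=
  match e with
  | POrc => app1 POrc (app1 PSucc (app2 padd first_zero (PProj 0)))
  | PComp f gs => PComp (offset f) [seq offset g | g <- gs]
  | PPrec f g => PPrec (offset f) (offset g)
  | PMu f => PMu (offset f)
  | _ => e
  end.

Section Offset.
Variables (D : nat -> bool) (z : nat).
Hypotheses (D_one : forall n, n < z -> D n) (D_zero : D z = false).

Lemma eval_first_zero xs : evalp D first_zero xs z.
Proof.
apply: ev_mu; first by have := ev_orc D (z :: xs); rewrite /= D_zero.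
by move=> n /D_one Dn; exists 0; have := ev_orc D (n :: xs); rewrite /= Dn.
Qed.

Lemma eval_offset e xs y :
  evalp (fun i => D (z + i).+1) e xs y -> evalp D (offset e) xs y.
Proof.
elim/prf_nested_ind: e xs y => [||i|| f gs IHf IHgs | f g IHf IHg | f IHf] xs y H /=.
1-3: by inversion H; constructor.
- inversion H as [ | | |xs1| | | | ]; subst; set i := nth 0 xs 0.
  apply: (@ev_comp _ _ _ _ [:: (z + i).+1]); last exact: (ev_orc D [:: (z + i).+1]).
  apply: evl_cons; last exact: evl_nil.
  apply: (@ev_comp _ _ _ _ [:: z + i]); last exact: (ev_succ D [:: z + i]).
  apply: evl_cons; last exact: evl_nil.
  apply: (@ev_comp _ _ _ _ [:: z; i]); last first.
    by rewrite -(ev_add D); apply: evalp_ev.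
  apply: evl_cons; first exact: eval_first_zero.
  by apply: evl_cons; [exact: ev_proj | exact: evl_nil].
- inversion H as [ | | | |f1 gs1 xs1 ys y1 Hgs Hf| | | ]; subst.
  apply: (ev_comp _ (IHf _ _ Hf)).
  elim: gs IHgs ys Hgs {H Hf} => [_|g gs IH /= [IHg IHgs]] ys Hgs.
    by inversion Hgs; apply: evl_nil.
  by inversion Hgs; subst; apply: evl_cons; [apply: IHg|apply: IH].
- case: xs H => [|n xs] H; first by inversion H.
  elim: n y H => [|n IHn] y H; inversion H as [ | | | | | |f1 g1 n1 xs1 r y1 Hr Hg| ]; subst.
    by apply: ev_prec0; apply: IHf.
  by apply: ev_precS (IHn _ Hr) (IHg _ _ Hg).
- inversion H as [ | | | | | | |f1 xs1 y1 H0 Hp]; subst.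
  apply: ev_mu (IHf _ _ H0) _ => t /Hp[v Hv]; exists v; exact: IHf.
Qed.
End Offset.

(** Ranks lie below the size of the alphabet, so reduction modulo that size isolates the first
    letter. *)
Lemma code_word_inj (S : finType) : injective (@code_word S).
Proof.
elim=> [|a u IH] [|b v] //= /eqP; rewrite !addSn // eqSS => /eqP E.
have N0 : 0 < #|S| by apply/card_gt0P; exists a.
have Ea : enum_rank a = enum_rank b :> nat.
  have /(congr1 (modn^~ #|S|)) := E.
  by rewrite ![#|S| * _]mulnC ![_ + _ * _]addnC !modnMDl !modn_small.
move: E; rewrite Ea => /addnI /eqP; rewrite eqn_pmul2l // => /eqP/IH->.
by rewrite (enum_rank_inj (val_inj Ea)).
Qed.

Section Reduction.
Variables (R : (nat -> bool) -> nat -> nat -> nat -> bool) (e : prf).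
Hypothesis e_computes : forall C m l w, evalp C e [:: m; l; w] (R C m l w).

(** The input is read off the tape as the predecessor of w + 1, the position of the first zero; thus
    one automaton serves all w. *)
Definition checker : prf :=
  PComp (offset e) [:: PProj 0; PProj 1; app1 ppred first_zero].

Lemma eval_checker (D : nat -> bool) w m l : (forall n, n <= w -> D n) -> D w.+1 = false ->
  evalp D checker [:: m; l] (R (fun i => D (w.+1 + i).+1) m l w).
Proof.
move=> D1 D0; apply: (@ev_comp _ _ _ _ [:: m; l; w]).
  apply: evl_cons; first exact: (ev_proj D 0 [:: m; l]).
  apply: evl_cons; first exact: (ev_proj D 1 [:: m; l]).
  apply: evl_cons; last exact: evl_nil.
  apply: (@ev_comp _ _ _ _ [:: w.+1]); last first.
    by have := @evalp_ev D ppred [:: w.+1] isT; rewrite ev_pred.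
  apply: evl_cons; last exact: evl_nil.
  by apply: eval_first_zero => // n; rewrite ltnS; apply: D1.
apply: (eval_offset (z := w.+1)) => // n; rewrite ltnS; exact: D1.
Qed.

Notation N := (last_pc checker).
Notation K := (maxreg checker).
Notation f := (ca (@machine_rule (program checker) N K)).
Notation S := (letters (state N) (tletter K)).

Definition origin_letter : S :=
  Some (Some (true, (true, false, [ffun _ => false]), inl (inord 0, Search))).
Definition right_letter (b : bool) : S :=
  Some (Some (false, (b, false, [ffun _ => false]), inr false)).
Definition input_word w : seq S :=
  origin_letter :: rcons (nseq w (right_letter true)) (right_letter false).

Definition oracle (C : nat -> bool) w n := if n <= w then true else (w.+1 < n) && C (n - w.+2).

Lemma input_word_start C w :
  mkseq (fun i => config_of N K (oracle C w) 0 Search 0 (fun _ => false) zero (Posz i)) w.+2 =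
  input_word w.
Proof.
have zeros n : [ffun i : 'I_K.+1 => n < zero i] = [ffun _ => false].
  by apply/ffunP => i; rewrite !ffunE.
have sz : size (input_word w) = w.+2 by rewrite /= size_rcons size_nseq.
apply: (@eq_from_nth _ None) => [|i]; rewrite size_mkseq ?sz // => lti.
rewrite nth_mkseq //; case: i lti => [|i] lti; rewrite /= /tape zeros //.
rewrite nth_rcons size_nseq nth_nseq /oracle.
by case: (ltngtP i w) lti => [||->]; rewrite ?ltnn //; lia.
Qed.

Lemma input_word_computable : computable (fun w => code_word (input_word w)).
Proof.
pose rk a := (enum_rank (a : S)).+1.
pose p := app2 padd (pconst (rk origin_letter)) (app2 pmul (pconst #|S|)
  (PPrec (pconst (rk (right_letter false)))
    (app2 padd (pconst (rk (right_letter true))) (app2 pmul (pconst #|S|) (PProj 1))))).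
apply: (@primrec_computable p) => [|w].
  by rewrite /= !primrec_const; vm_compute.
rewrite /p ev_app2 ev_const ev_add ev_app2 ev_const ev_mul /input_word.
rewrite -[code_word _]/(rk _ + #|S| * code_word _); congr (_ + _ * _).
elim: w => [|w IH]; first by rewrite ev_PPrec0 ev_const /= muln0 addn0.
by rewrite ev_PPrecS IH !evE.
Qed.

Lemma reduction : many_one (fun w => exists C, forall m, exists l, R C m l w)
  (language (nonwandering f)).
Proof.
exists (fun w => code_word (input_word w)); split; first exact: input_word_computable.
move=> w; split=> [[C HC]|[y [rec_y [k Ek]]]].
  exists (config_of N K (oracle C w) 0 Search 0 (fun _ => false) zero); split; last first.
    by exists w.+2; rewrite input_word_start.
  have Dw n : n <= w -> oracle C w n by rewrite /oracle => ->.
  have Dw1 : oracle C w w.+1 = false by rewrite /oracle !ltnn.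
  apply: (recurrent_start (r := fun m l => R (fun i => oracle C w (w.+1 + i).+1) m l w)
    (fun m l => eval_checker m l Dw Dw1)) => m.
  have [l Rl] := HC m; exists l; rewrite (_ : (fun i => _) = C) //.
  apply/funext => i; rewrite /oracle ifN; last by lia.
  by rewrite (_ : w.+1 < _) /=; [congr C; lia | lia].
have {Ek} Ew := code_word_inj Ek.
have szw : size (input_word w) = w.+2 by rewrite /= size_rcons size_nseq.
have Ek : k = w.+2 by rewrite -szw Ew size_mkseq.
have yw i : i < w.+2 -> y (Posz i) = nth None (input_word w) i.
  by move=> lti; rewrite Ew nth_mkseq // Ek.
have [|T [Ey T0 cT]] := recurrent_enc rec_y _ (yw 0 isT); first by rewrite (yw 0).
(* The word fixes only finitely many cells; [monotone] carries the emptiness of the registers on to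
   all others. *)
have T2 n : (T n).2 = [ffun _ => false].
  elim: n => [|n IH]; first by rewrite T0.
  apply/ffunP => i; have /forallP/(_ i) := cT n; rewrite IH !ffunE.
  by case: ((T n.+1).2 i).
pose D n := (T n).1.1; pose od n := (T n).1.2.
have {Ey} Ey : y = config_of N K D 0 Search 0 od zero.
  rewrite Ey /config_of; congr enc; apply/funext => n; rewrite /tape /D /od.
  by case: (T n) (T2 n) => [[d o] c] /= -> ; congr (_, _).
have Dnth n b : n < w.+2 -> nth None (input_word w) n = right_letter b -> D n = b.
  by move=> ltn Eb; have := yw n ltn; rewrite Eb Ey => -[].
have Dw n : n <= w -> D n.
  case: n => [|n] ltn; first by rewrite /D T0.
  by rewrite (Dnth n.+1 true) // /= ?nth_rcons ?size_nseq ?ltn ?nth_nseq ?ltn //; lia.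
have Dw1 : D w.+1 = false.
  by apply: Dnth => //=; rewrite nth_rcons size_nseq ltnn eqxx.
exists (fun i => D (w.+1 + i).+1) => m.
rewrite Ey in rec_y.
have [l Hl] := recurrent_verified (r := fun m l => R (fun i => D (w.+1 + i).+1) m l w)
  (fun m l => eval_checker m l Dw Dw1) rec_y m.
by exists l.
Qed.
End Reduction.

Theorem theorem3 :
  (forall P : nat -> Prop, Sigma11 P ->
     exists (S : finType) (f : config S -> config S),
       cellular_automaton f /\ many_one P (language (nonwandering f)))
  /\
  (exists (S : finType) (f : config S -> config S),
       cellular_automaton f /\ Sigma11_complete (language (nonwandering f))).
Proof.
have red P : Sigma11 P -> exists (S : finType) (s : S) (F : S -> S -> S -> S),
    many_one P (language (nonwandering (ca F))).
  move=> [R [[e He] PR]]; have [h [hc hR]] := reduction He.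
  eexists _, None, (@machine_rule (program (checker e)) _ _), h.
  by split=> // w; rewrite PR; apply: hR.
split=> [P /red[S [s [F HF]]]|].
  by exists S, (ca F); split=> //; apply: ca_cellular_automaton.
(* An automaton hard for the universal set is hard for all, since every set reduces to the universal
   one. *)
have [S [s [F HF]]] := red _ Sigma11_univ.
exists S, (ca F); split; first exact: ca_cellular_automaton.
split=> [|P /Sigma11_univ_reduce HP]; first exact: Sigma11_language.
exact: many_one_trans HP HF.
Qed.
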